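(* Let $N\ge2$, let $\mu$ be a Borel probability measure on a domain $\Omega\subset\mathbb{R}^d$, and let $c:\Omega^N\to\mathbb{R}$ be continuous and bounded above. Assume that the infimum $$\inf\Big\{\int_\Omega \ell^c_H(x)\,d\mu(x):\ H\in\mathcal{H}_N(\Omega)\Big\}$$ is attained at some $H_\infty\in\mathcal{H}_N(\Omega)$ such that, for $\mu$-almost every $x\in\Omega$, the map $$(x_2,\dots,x_N)\mapsto c(x,x_2,\dots,x_N)-H_\infty(x,x_2,\dots,x_N)$$ attains its maximum over $\Omega^{N-1}$ at a unique point. Then the supremum $$\mathrm{MK}_{\rm cyc}(c,\mu)=\sup\Big\{\int_{\Omega}c(x,Sx,\dots,S^{N-1}x)\,d\mu(x):\ S:\Omega\to\Omega\ \text{is }\mu\text{-measure preserving and }S^N=I\ \mu\text{-a.e.}\Big\}$$ is attained.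
   Context: $\sigma(x_1,\dots,x_N)=(x_2,\dots,x_N,x_1)$ on $\Omega^N$. $\mathcal{H}_N(\Omega)=\{H\in C(\Omega^N;\mathbb{R}):\ \sum_{i=0}^{N-1}H(\sigma^i(\mathbf{x}))=0\ \text{for all }\mathbf{x}\in\Omega^N\}$. For $H\in\mathcal{H}_N(\Omega)$, $$\ell_H^c(x)=\sup\{c(x,x_2,\dots,x_N)-H(x,x_2,\dots,x_N):\ (x_2,\dots,x_N)\in\Omega^{N-1}\}.$$ A map $S$ is $\mu$-measure preserving if it is measurable and $S_\#\mu=\mu$. *)

(* Defs.v *)
From HB Require Import structures.
From mathcomp Require Import all_boot all_order all_algebra.
From mathcomp Require Import all_classical all_reals all_analysis.

Set Implicit Arguments.
Unset Strict Implicit.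
Unset Printing Implicit Defensive.

Import Order.TTheory GRing.Theory Num.Theory.
Import numFieldNormedType.Exports.

Local Open Scope classical_set_scope.
Local Open Scope ring_scope.

(* The subtype of points of Om with the subset topology. MathComp-Analysis
   requires measurable types to be pointed, hence the nonemptiness argument;
   the chosen point plays no role. *)
Definition points (X : topologicalType) (Om : set X) (Om0 : Om !=set0) : Type :=
  set_type Om.

HB.instance Definition _ (X : topologicalType) (Om : set X) (Om0 : Om !=set0) :=
  Topological.copy (points Om0) (set_type Om).

HB.instance Definition _ (X : topologicalType) (Om : set X) (Om0 : Om !=set0) :=
  isPointed.Build (points Om0)
    (exist (fun x => x \in Om) (sval (cid Om0)) (mem_set (svalP (cid Om0)))).

Notation borel T := (g_sigma_algebraType (@open T)).

(* T^N is {ptws 'I_N -> T}, that is 'I_N -> T with the product topology;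
   coordinates are numbered from 0. *)
Section cyclic_transport.
Context {R : realType} {T : ptopologicalType}.

Definition cyc_shift N (x : {ptws 'I_N -> T}) : {ptws 'I_N -> T} :=
  fun i => x (ordS i).

Definition cyc_null N : set ({ptws 'I_N -> T} -> R) :=
  [set H | continuous H /\
    forall x, \sum_(i < N) H (iter i (@cyc_shift N) x) = 0].

(* The point (x, y_0, ..., y_(n-1)). *)
Definition fcons n (x : T) (y : {ptws 'I_n -> T}) : {ptws 'I_n.+1 -> T} :=
  fun i => oapp y x (unlift ord0 i).

Definition ell n (c H : {ptws 'I_n.+1 -> T} -> R) (x : T) : \bar R :=
  ereal_sup [set (c (fcons x y) - H (fcons x y))%:E | y in setT].

Definition itinerary N (S : T -> T) (x : T) : {ptws 'I_N -> T} :=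
  fun i => iter i S x.

Variable mu : probability (borel T) R.

(* The integral of f makes sense in [-oo, +oo]. The library integral is total:
   where this fails it is (+oo) - (+oo) = -oo. *)
Definition has_integral (f : T -> \bar R) : Prop :=
  (\int[mu]_x (f^\+ x) < +oo \/ \int[mu]_x (f^\- x) < +oo)%E.

Definition dual_admissible n (c : {ptws 'I_n.+1 -> T} -> R) :
    set ({ptws 'I_n.+1 -> T} -> R) :=
  [set H | cyc_null H /\ has_integral (ell c H)].

Definition dual_cost n (c H : {ptws 'I_n.+1 -> T} -> R) : \bar R :=
  (\int[mu]_x ell c H x)%E.

Definition dual_value n (c : {ptws 'I_n.+1 -> T} -> R) : \bar R :=
  ereal_inf [set dual_cost c H | H in dual_admissible c].

Definition measure_preserving (S : borel T -> borel T) : Prop :=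
  measurable_fun setT S /\
  forall A, measurable A -> pushforward mu S A = mu A.

Definition cyc_map N : set (T -> T) :=
  [set S | measure_preserving S /\ {ae mu, forall x, iter N S x = x}].

Definition cyc_cost N (c : {ptws 'I_N -> T} -> R) (S : T -> T) : \bar R :=
  (\int[mu]_x (c (@itinerary N S x))%:E)%E.

Definition MK_cyc N (c : {ptws 'I_N -> T} -> R) : \bar R :=
  ereal_sup [set cyc_cost c S | S in cyc_map N].

End cyclic_transport.

(* Main.v *)
(* Let P x = (x, y) where y is the unique maximiser of c - H over the fibre above
   x, H being the optimal potential. Weak duality holds because, for a cyclic S,
   the H terms cancel in the sum of c - H over the orbit of x, so that
   int c(x, S x, ...) <= int ell_H; in particular every S is optimal when
   int ell_H = -oo. Otherwise ell_H is integrable, and differentiating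
   r |-> int ell_(H + r Q) at r = 0 yields int G (P x) = 0 for every bounded G in
   H_N, that is, the law of P x is invariant under the cyclic shift. As this law
   is carried by a graph, S := P_1 preserves mu, P = (I, S, ..., S^(N-1)) and
   S^N = I almost everywhere, and S attains the bound int ell_H.

   Since Omega is not compact, near-maximisers of c - H may escape to infinity
   and the derivative in the direction G cannot be computed directly. One takes
   instead Q = G + M sum_i (w (z_i) - w (z_0)) with M = 2 sup |G| and w equal to 1
   off a compact set: the escaping points are then not competitive, and the
   error is O(int w), which tends to 0 along an exhaustion of Omega. *)

Require Import Defs.
From HB Require Import structures.
From mathcomp Require Import all_boot all_order all_algebra.
From mathcomp Require Import all_classical all_reals all_analysis.
From mathcomp Require Import measurable_realfun ring lra.
Set Implicit Arguments.
Unset Strict Implicit.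
Unset Printing Implicit Defensive.
Import Order.TTheory GRing.Theory Num.Theory.
Import numFieldNormedType.Exports.
Local Open Scope classical_set_scope.
Local Open Scope ring_scope.

(** * Finite powers of a topological space *)

Lemma ptws_continuous (S T : topologicalType) (I : Type)
    (g : S -> {ptws I -> T}) :
  (forall i, continuous (fun s => g s i)) -> continuous g.
Proof.
move=> cg s; apply/cvg_sup => i; move: s.
apply/(@continuousP _ (initial_topology (@^~ i))) => _ [B oB <-].
rewrite -[g @^-1` _]/((fun s => g s i) @^-1` B).
by move/continuousP : (cg i); exact.
Qed.

Lemma ptws_proj_continuous (T : topologicalType) (I : eqType) (i : I) :
  continuous (fun x : {ptws I -> T} => x i).
Proof. exact: (@proj_continuous I (fun=> T) i). Qed.

(** The filter generated by boxes around [x] converges to [x] in each coordinate, hence in the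
    product topology, so it contains every neighbourhood of [x]. *)
Lemma ptws_nbhs_box (T : topologicalType) m (x : {ptws 'I_m -> T})
    (U : set {ptws 'I_m -> T}) : nbhs x U ->
  exists2 V : 'I_m -> set T, (forall i, nbhs (x i) (V i)) &
    forall y : {ptws 'I_m -> T}, (forall i, V i (y i)) -> U y.
Proof.
pose F := filter_from [set V : 'I_m -> set T | forall i, nbhs (x i) (V i)]
  (fun V => [set y : {ptws 'I_m -> T} | forall i, V i (y i)]).
have FF : Filter F.
  apply: filter_from_filter; first by exists (fun=> setT) => i; exact: filterT.
  move=> V W nV nW; exists (fun i => V i `&` W i) => [i|y VW].
    by apply: filterI; [exact: nV|exact: nW].
  by split=> i; have [] := VW i.
suff : F --> x by move=> /[apply] -[V nV VU]; exists V.
apply/cvg_sup => i A.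
rewrite (@nbhsE (initial_topology (@^~ i)))/= => -[_ [[B oB <-] Bx] BA].
exists (fun j => if j == i then B else setT).
  move=> j /=; case: eqP => [->|_]; last exact: filterT.
  exact: open_nbhs_nbhs.
by move=> y /(_ i); rewrite eqxx => /BA.
Qed.

Lemma continuous_compact_max (R : realType) (T : topologicalType) (A : set T)
    (f : T -> R) : compact A -> A !=set0 -> continuous f ->
  exists2 p, A p & forall q, A q -> f q <= f p.
Proof.
move=> cA [a Aa] cf.
have cfA : compact (f @` A).
  by apply: continuous_compact => //; exact: continuous_subspaceT.
have fA0 : f @` A !=set0 by exists (f a), a.
have bfA : has_ubound (f @` A).
  by have [M [_ /(_ (M + 1))]] := compact_bounded cfA;
    rewrite ltrDl ltr01 => /(_ isT) bM; exists (M + 1) => y /bM;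
    apply/le_trans/ler_norm.
have clfA : closed (f @` A) by apply: compact_closed => //; exact: Rhausdorff.
have [p Ap fp] : (f @` A) (sup (f @` A)).
  rewrite [X in X _](closure_id _).1//; apply: closure_sup => //.
exists p => // q Aq; rewrite fp; apply: ub_le_sup => //; by exists q.
Qed.

Section coordinates.
Context {T : ptopologicalType}.

Lemma fcons0 n (x : T) (y : {ptws 'I_n -> T}) : fcons x y ord0 = x.
Proof. by rewrite /fcons unlift_none. Qed.

Lemma fcons_lift n (x : T) (y : {ptws 'I_n -> T}) i :
  fcons x y (lift ord0 i) = y i.
Proof. by rewrite /fcons liftK. Qed.

Lemma fcons_eta n (x : {ptws 'I_n.+1 -> T}) :
  fcons (x ord0) (fun i => x (lift ord0 i)) = x.
Proof.
by apply/funext => i; case: (unliftP ord0 i) => [j ->|->];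
  rewrite ?fcons_lift ?fcons0.
Qed.

Lemma fcons_continuousl n (y : {ptws 'I_n -> T}) :
  continuous (fun x : T => fcons x y).
Proof.
apply: ptws_continuous => i; case: (unliftP ord0 i) => [j ->|->].
  under eq_fun do rewrite fcons_lift; exact: cst_continuous.
under eq_fun do rewrite fcons0; by move=> ?; exact: cvg_id.
Qed.

Lemma fcons_continuousr n (x : T) :
  continuous (fun y : {ptws 'I_n -> T} => fcons x y).
Proof.
apply: ptws_continuous => i; case: (unliftP ord0 i) => [j ->|->].
  have -> : (fun y : {ptws 'I_n -> T} => fcons x y (lift ord0 j)) =
      (fun y => y j) by apply/funext => y; rewrite fcons_lift.
  exact: ptws_proj_continuous.
have -> : (fun y : {ptws 'I_n -> T} => fcons x y ord0) = cst x.
  by apply/funext => y; rewrite fcons0.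
exact: cst_continuous.
Qed.

Lemma iter_cyc_shift N k (x : {ptws 'I_N -> T}) i :
  iter k (@cyc_shift T N) x i = x (iter k (@ordS N) i).
Proof. by elim: k x i => //= k IH x i; rewrite /cyc_shift IH -iterSr. Qed.

Lemma val_iter_ordS N k (i : 'I_N) :
  iter k (@ordS N) i = ((i + k) %% N)%N :> nat.
Proof.
elim: k => [|k IH]; first by rewrite addn0 modn_small.
by rewrite iterS /= IH -addn1 modnDml addn1 addnS.
Qed.

Lemma iter_cyc_shift_id N (x : {ptws 'I_N -> T}) :
  iter N (@cyc_shift T N) x = x.
Proof.
apply/funext => i; rewrite iter_cyc_shift; congr x; apply/val_inj.
by apply: etrans (val_iter_ordS N i) _; rewrite modnDr modn_small.
Qed.

End coordinates.

(** * Borel measurability *)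

Section borel_measurability.
Context {R : realType} {T : ptopologicalType}.

Lemma open_borel (U : set T) : open U -> measurable (U : set (borel T)).
Proof. exact: sub_sigma_algebra. Qed.

Lemma closed_borel (F : set T) : closed F -> measurable (F : set (borel T)).
Proof.
move=> cF; rewrite -(setCK F); apply: measurableC; apply: open_borel.
exact: closed_openC.
Qed.

Lemma borel_measurable_closed d (X : measurableType d) (g : X -> borel T) :
  (forall F : set T, closed F -> measurable (g @^-1` F)) ->
  measurable_fun setT g.
Proof.
move=> mg; apply: (measurability (@open T : set (set (borel T)))) => //.
move=> _ [U oU <-].
rewrite setTI -[U]setCK preimage_setC; apply: measurableC.
by apply: (mg (~` U)); exact: open_closedC.
Qed.

Lemma continuous_borel_measurable (f : T -> R) : continuous f ->
  @measurable_fun _ _ (borel T) R setT f.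
Proof.
move=> /continuousP cf.
apply: (measurability _ (RGenOpens.measurableE R)) => _ [_ [a [b ->] <-]].
by rewrite setTI; apply: open_borel; apply: cf; exact: interval_open.
Qed.

Lemma second_countable_enum : @second_countable T ->
  exists2 E : nat -> set T, (forall k, open (E k)) &
    forall x U, nbhs x U -> exists2 k, E k x & E k `<=` U.
Proof.
move=> [B /pfcard_geP cB [Bo Bn]].
(* An empty base is excluded: it would leave [point] without a basic neighbourhood. *)
case: cB => [B0|[f]].
  by have [V [+ _] _] := Bn point setT filterT; rewrite B0.
have fB k : B (f k) by exact: (@funS _ _ _ _ f).
exists f => [k|x U /Bn[V [BV Vx] VU]]; first exact: Bo.
by have [k _ fk] := @surj _ _ _ _ f V BV; exists k; rewrite fk.
Qed.

(** By second countability an open set of the power is a countable union of boxes with basic sides,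
    and the preimage of such a box is a finite intersection of measurable sets. *)
Lemma continuous_comp_measurable d (X : measurableType d) N
    (g : 'I_N -> X -> borel T) (F : {ptws 'I_N -> T} -> R) :
  @second_countable T -> (forall i, measurable_fun setT (g i)) ->
  continuous F -> measurable_fun setT (fun x => F (fun i => g i x)).
Proof.
move=> /second_countable_enum[E oE nE] mg /continuousP cF.
apply: (measurability _ (RGenOpens.measurableE R)) => _ [_ [a [b ->] <-]].
rewrite setTI; set O := `]a, b[%classic.
have {cF}/cF : open O by exact: interval_open.
set W := _ @^-1` _ => oW.
pose box (e : {ffun 'I_N -> nat}) : set {ptws 'I_N -> T} :=
  [set y | forall i, E (e i) (y i)].
rewrite (_ : _ @^-1` _ = \bigcup_e
    (if `[< box e `<=` W >] then \bigcap_i (g i @^-1` E (e i)) else set0)).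
  apply: countable_bigcupT_measurable => // e; case: asboolP => // _.
  apply: fin_bigcap_measurable => // i _.
  rewrite -[X in measurable X]setTI; apply: (mg i) => //.
  exact: (open_borel (oE _)).
apply/seteqP; split=> [x Wx|x [e _]]; last first.
  by case: asboolP => // bW xe; apply: (bW (fun i => g i x)) => i; exact: xe.
have /ptws_nbhs_box[V nV VW] : nbhs ((fun i => g i x) : {ptws 'I_N -> T}) W.
  exact: open_nbhs_nbhs.
have /choice[k kP] i : exists k, E k (g i x) /\ E k `<=` V i.
  by have [k] := nE _ _ (nV i); exists k.
exists [ffun i => k i] => //; case: asboolP => [_ i _ /=|[]].
  by rewrite ffunE; exact: (kP i).1.
by move=> y ye; apply: VW => i; apply: (kP i).2; have := ye i; rewrite ffunE.
Qed.

(* By lower semicontinuity, which is why no condition on Y is needed. *)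
Lemma measurable_sup_fcons n (phi : {ptws 'I_n.+1 -> T} -> R)
    (Y : set {ptws 'I_n -> T}) : continuous phi ->
  @measurable_fun _ _ (borel T) (\bar R) setT
    (fun x => ereal_sup [set (phi (fcons x y))%:E | y in Y]).
Proof.
move=> cphi; apply: (measurability _ (ErealGenOInfty.measurableE R)).
move=> _ [_ [a ->] <-]; rewrite setTI; apply: open_borel.
rewrite [X in open X](_ : _ = \bigcup_(y in Y)
    ((fun x => phi (fcons x y)) @^-1` [set r | a < r])).
  apply: bigcup_open => y _.
  have /continuousP : continuous (fun x => phi (fcons x y)).
    by move=> x; apply: continuous_comp; [exact: fcons_continuousl|exact: cphi].
  by apply; exact: open_gt.
apply/seteqP; split=> x /=; rewrite in_itv/= andbT.
  by move=> /ereal_sup_gt[_ [y Yy <-]]; rewrite lte_fin; exists y.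
move=> [y Yy /=]; rewrite -lte_fin => /lt_le_trans; apply.
by apply: ereal_sup_ubound; exists y.
Qed.

Lemma measurable_ell n (c H : {ptws 'I_n.+1 -> T} -> R) :
  continuous c -> continuous H ->
  @measurable_fun _ _ (borel T) (\bar R) setT (ell c H).
Proof.
move=> cc cH.
apply: (@measurable_sup_fcons _ (fun z => c z - H z) setT) => x.
by apply: cvgB; [exact: cc|exact: cH].
Qed.

End borel_measurability.

(** * Integrals along orbits *)

Section integration.
Local Open Scope ereal_scope.
Context d (X : measurableType d) (R : realType).
Variable mu : {measure set X -> \bar R}.

Lemma aeS (P Q : X -> Prop) : {ae mu, forall x, P x} ->
  (forall x, P x -> Q x) -> {ae mu, forall x, Q x}.
Proof. by move=> aeP PQ; apply: filterS aeP. Qed.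

Lemma aeI (P Q : X -> Prop) : {ae mu, forall x, P x} ->
  {ae mu, forall x, Q x} -> {ae mu, forall x, P x /\ Q x}.
Proof. by move=> aeP aeQ; apply/near_andP. Qed.

(** Positive and negative parts are compared separately; subtraction stays monotone under the
    convention (+oo) - (+oo) = -oo, so functions without an integral are covered too. *)
Lemma ae_le_integral (f g : X -> \bar R) :
  measurable_fun setT f -> measurable_fun setT g ->
  {ae mu, forall x, f x <= g x} -> \int[mu]_x f x <= \int[mu]_x g x.
Proof.
move=> mf mg fg; rewrite [leLHS]integralE [leRHS]integralE.
apply: leeB; apply: ae_ge0_le_integral => //.
- exact: measurable_funepos.
- exact: measurable_funepos.
- apply: filterS fg => x fgx _.
  by rewrite !funeposE ge_max !le_max fgx lexx orbT.
- exact: measurable_funeneg.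
- exact: measurable_funeneg.
- apply: filterS fg => x fgx _.
  by rewrite !funenegE ge_max !le_max leeN2 fgx lexx orbT.
Qed.

(** The positive part being integrable, integrability can only fail through an infinite integral of
    the negative part. *)
Lemma integral_Ny (f : X -> R) :
  measurable_fun setT f ->
  mu.-integrable setT (fun x => (Num.max (f x) 0)%:E) ->
  ~ mu.-integrable setT (EFin \o f) -> \int[mu]_x (f x)%:E = -oo.
Proof.
move=> mf ifp nif.
have mEf : measurable_fun setT (EFin \o f) by exact/measurable_EFinP.
have fpE : (EFin \o f)^\+ = (fun x => (Num.max (f x) 0)%:E).
  by apply/funext => x; rewrite funeposE/= EFin_max.
have fp_fin : \int[mu]_x (EFin \o f)^\+ x \is a fin_num.
  by rewrite fpE; exact: integrable_fin_num.
have fn_ge0 : 0 <= \int[mu]_x (EFin \o f)^\- x by exact: integral_ge0.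
have fnoo : \int[mu]_x (EFin \o f)^\- x = +oo.
  apply/eqP; rewrite -leye_eq leNgt; apply/negP => fn_lty; apply: nif.
  rewrite [EFin \o f]funeposneg; apply: integrableB => //; first by rewrite fpE.
  apply/integrableP; split; first exact: measurable_funeneg.
  by under eq_integral do rewrite gee0_abs//.
rewrite [LHS]integralE -[X in X - _]/(\int[mu]_x (EFin \o f)^\+ x).
rewrite -[X in _ - X]/(\int[mu]_x (EFin \o f)^\- x) fnoo.
by move: fp_fin; case: (integral _ _ _).
Qed.

End integration.

Section orbits.
Local Open Scope ereal_scope.
Context d (X : measurableType d) (R : realType).
Variable mu : {measure set X -> \bar R}.
Variable S : X -> X.
Hypothesis mS : measurable_fun setT S.
Hypothesis muS : forall A, measurable A -> pushforward mu S A = mu A.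

Lemma iter_measurable k : measurable_fun setT (iter k S).
Proof.
elim: k => [|k IH]; first exact: measurable_id.
by rewrite (_ : iter k.+1 S = S \o iter k S)//; exact: measurableT_comp.
Qed.

Lemma iter_preserving k A : measurable A -> mu (iter k S @^-1` A) = mu A.
Proof.
elim: k A => [//|k IH] A mA.
rewrite (_ : iter k.+1 S @^-1` A = iter k S @^-1` (S @^-1` A))// IH; last first.
  by rewrite -[X in measurable X]setTI; exact: mS.
exact: muS.
Qed.

Lemma ae_iter k (P : X -> Prop) : {ae mu, forall x, P x} ->
  {ae mu, forall x, P (iter k S x)}.
Proof.
move=> [A [mA A0 PA]]; exists (iter k S @^-1` A); split.
- by rewrite -[X in measurable X]setTI; exact: iter_measurable.
- by rewrite iter_preserving.
- by move=> x nP; exact: PA.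
Qed.

(** Change of variables: each iterate of [S] pushes [mu] forward to itself. *)
Lemma integrable_iter k (f : X -> R) :
  mu.-integrable setT (EFin \o f) ->
  mu.-integrable setT (fun x => (f (iter k S x))%:E) /\
  \int[mu]_x (f (iter k S x))%:E = \int[mu]_x (f x)%:E.
Proof.
move=> intf; have mf := measurable_int _ intf.
have mk := iter_measurable k.
have intfk : mu.-integrable setT ((EFin \o f) \o iter k S).
  apply/integrableP; split; first exact: measurableT_comp.
  rewrite -(preimage_setT (iter k S)).
  have mabs : measurable_fun setT (abse \o (EFin \o f)).
    exact: measurableT_comp.
  rewrite -(ge0_integral_pushforward mk mu measurableT mabs); last first.
    by move=> y _; exact: abse_ge0.
  rewrite (eq_measure_integral mu); last first.
    by move=> A mA _; exact: iter_preserving.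
  by have /integrableP[] := intf.
split => //.
rewrite -[LHS]/(\int[mu]_x ((EFin \o f) \o iter k S) x).
rewrite -[X in \int[mu]_(x in X) _](preimage_setT (iter k S)).
rewrite -integral_pushforward//.
by apply: eq_measure_integral => A mA _; exact: iter_preserving.
Qed.

(* The orbit sums have N times the integrals of f and g when these are
   integrable; integrability of f passes to g since g^- is dominated by the
   orbit sums of |f| and g^+. *)
Lemma orbit_le_integral (N : nat) (f g : X -> R) : (0 < N)%N ->
  measurable_fun setT f -> measurable_fun setT g ->
  mu.-integrable setT (fun x => (Num.max (f x) 0)%:E) ->
  mu.-integrable setT (fun x => (Num.max (g x) 0)%:E) ->
  {ae mu, forall x, (\sum_(i < N) f (iter i S x) <=
                     \sum_(i < N) g (iter i S x))%R} ->
  \int[mu]_x (f x)%:E <= \int[mu]_x (g x)%:E.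
Proof.
move=> N0 mf mg ifp igp fg.
have [intf|nintf] := pselect (mu.-integrable setT (EFin \o f)); last first.
  by rewrite (integral_Ny mf ifp nintf) leNye.
have mEf : measurable_fun setT (EFin \o f) by exact/measurable_EFinP.
have mEg : measurable_fun setT (EFin \o g) by exact/measurable_EFinP.
have intaf : mu.-integrable setT (EFin \o (fun x => `|f x|%R)).
  by rewrite (_ : _ \o _ = abse \o (EFin \o f))//; exact: integrable_abse.
pose b x := (\sum_(i < N) `|f (iter i S x)| +
             \sum_(i < N) Num.max (g (iter i S x)) 0)%R.
have intb : mu.-integrable setT (EFin \o b).
  rewrite (_ : EFin \o b = (fun x => \sum_(i < N) (`|f (iter i S x)|%R)%:E) \+
      (fun x => \sum_(i < N) (Num.max (g (iter i S x)) 0)%:E)); last first.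
    by apply/funext => x /=; rewrite /b EFinD !sumEFin.
  apply: integrableD => //; apply: integrable_sum => // i _.
    exact: (integrable_iter i intaf).1.
  exact: (integrable_iter i (f := fun x => Num.max (g x) 0%R) igp).1.
(* The term [i = 0] of the orbit sum of [g] is [g x]. It is at least the orbit sum of [f] minus the
   other terms, which are at most their positive parts. *)
have gb : {ae mu, forall x, (- b x <= g x)%R}.
  apply: filterS fg => x; case: N N0 @b intb => // n _ b _.
  rewrite [X in (_ <= X)%R -> _]big_ord_recl /= => fgx; rewrite /b.
  rewrite lerNl; apply: (@le_trans _ _ (- \sum_(i < n.+1) f (iter i S x) +
      \sum_(i < n) g (iter (bump 0 i) S x))%R); first by lra.
  rewrite lerD//.
    by rewrite -sumrN ler_sum// => i _; rewrite -normrN ler_norm.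
  rewrite [leRHS]big_ord_recl ler_wpDl//; first by rewrite le_max lexx orbT.
  by apply: ler_sum => i _; rewrite le_max lexx.
(* A non-integrable [g] would have integral -oo, below the finite integral of its minorant [- b]. *)
have [intg|nintg] := pselect (mu.-integrable setT (EFin \o g)); last first.
  have intNb : mu.-integrable setT (fun x => (- b x)%:E).
    by rewrite (_ : (fun _ => _) = (\- (EFin \o b))%E)//; exact: integrableN.
  have : \int[mu]_x (- b x)%:E <= \int[mu]_x (g x)%:E.
    apply: ae_le_integral; [exact: measurable_int intNb|exact: mEg|].
    by apply: filterS gb => x; rewrite lee_fin.
  rewrite (integral_Ny mg igp nintg) leeNy_eq => /eqP h.
  by have := integrable_fin_num measurableT intNb; rewrite h.
have sumE h : mu.-integrable setT (EFin \o h) ->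
    \int[mu]_x (\sum_(i < N) h (iter i S x))%:E = N%:R%:E * \int[mu]_x (h x)%:E.
  move=> inth; under eq_integral do rewrite -sumEFin.
  rewrite integral_sum//; last by move=> i; exact: (integrable_iter i inth).1.
  under eq_bigr do rewrite (integrable_iter _ inth).2.
  by rewrite sumr_const card_ord mule_natl.
have msum (h : X -> R) : measurable_fun setT h ->
    @measurable_fun _ _ X (\bar R) setT
      (fun x => (\sum_(i < N) h (iter i S x))%:E).
  move=> mh; under eq_fun do rewrite -sumEFin.
  apply: emeasurable_sum => i; apply/measurable_EFinP.
  by apply: measurableT_comp => //; exact: iter_measurable.
have : \int[mu]_x (\sum_(i < N) f (iter i S x))%:E <=
       \int[mu]_x (\sum_(i < N) g (iter i S x))%:E.
  by apply: ae_le_integral; [exact: msum|exact: msum|exact: fg].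
rewrite !sumE// lee_pmul2l//; last by rewrite lte_fin ltr0n.
Qed.

End orbits.

Section integrability.
Context d (X : measurableType d) (R : realType).

Lemma bounded_integrable (mu : {finite_measure set X -> \bar R})
    (f : X -> R) b :
  measurable_fun setT f -> (forall x, `|f x| <= b) ->
  mu.-integrable setT (EFin \o f).
Proof.
move=> mf fb; apply: (le_integrable measurableT (g := EFin \o cst b)).
- exact/measurable_EFinP.
- by move=> x _ /=; rewrite lee_fin (le_trans (fb x))// ler_norm.
- exact: finite_measure_integrable_cst.
Qed.

Lemma ae_le_integrable (mu : {measure set X -> \bar R}) (f g : X -> \bar R) :
  measurable_fun setT f -> mu.-integrable setT g ->
  {ae mu, forall x, (`|f x| <= `|g x|)%E} -> mu.-integrable setT f.
Proof.
move=> mf /integrableP[mg intg] fg; apply/integrableP; split => //.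
apply: le_lt_trans intg; apply: ae_le_integral => //; exact: measurableT_comp.
Qed.

End integrability.

(** * Cyclically null functions *)

Section cyclic_null.
Context {R : realType} {T : ptopologicalType}.

(** Starting one step later moves the first term to the end, because the N-th power of the shift is
    the identity. *)
Lemma sum_iter_cyc_shift N k (G : {ptws 'I_N -> T} -> R) x :
  \sum_(i < N) G (iter i (@cyc_shift T N) (iter k (@cyc_shift T N) x)) =
  \sum_(i < N) G (iter i (@cyc_shift T N) x).
Proof.
case: N G x => [|N] G x; first by rewrite !big_ord0.
elim: k => [//|k <-]; set y := iter k _ x.
under eq_bigr do rewrite iterS -iterSr.
rewrite [LHS]big_ord_recr [RHS]big_ord_recl /= addrC; congr (G _ + _).
exact: (@iter_cyc_shift_id T N.+1 y).
Qed.

Lemma iter_cyc_shift_continuous N k : continuous (iter k (@cyc_shift T N)).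
Proof.
apply: ptws_continuous => i.
have -> : (fun x : {ptws 'I_N -> T} => iter k (@cyc_shift T N) x i) =
    (fun x => x (iter k (@ordS N) i)).
  by apply/funext => x; rewrite iter_cyc_shift.
exact: ptws_proj_continuous.
Qed.

(** Both terms have the same orbit sum. These coboundaries are the test functions: a law
    annihilating the bounded ones with [k = 1] is to be shown invariant under the shift. *)
Lemma cyc_null_shiftB N k (G : {ptws 'I_N -> T} -> R) : continuous G ->
  cyc_null (fun x => G (iter k (@cyc_shift T N) x) - G x).
Proof.
move=> cG; split=> [x|x].
  apply: cvgB; last exact: cG.
  by apply: continuous_comp; [exact: iter_cyc_shift_continuous|exact: cG].
rewrite big_split/= sumrN -(sum_iter_cyc_shift k G x) -sumrB big1// => i _.
by rewrite -!iterD addnC subrr.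
Qed.

Lemma cyc_nullD N (G H : {ptws 'I_N -> T} -> R) :
  cyc_null G -> cyc_null H -> cyc_null (fun x => G x + H x).
Proof.
move=> [cG G0] [cH H0]; split=> [x|x].
  by apply: cvgD; [exact: cG|exact: cH].
by rewrite big_split/= G0 H0 addr0.
Qed.

Lemma cyc_nullM N a (H : {ptws 'I_N -> T} -> R) :
  cyc_null H -> cyc_null (fun x => a * H x).
Proof.
move=> [cH H0]; split=> [x|x]; last by rewrite -mulr_sumr H0 mulr0.
by apply: cvgM; [exact: cvg_cst|exact: cH].
Qed.

Lemma cyc_null0 N : cyc_null (fun=> 0 : R) (N := N) (T := T).
Proof. by split=> [x|x]; [exact: cvg_cst|rewrite big1]. Qed.

Lemma cyc_null_sum N (I : Type) (r : seq I) (H : I -> {ptws 'I_N -> T} -> R) :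
  (forall i, cyc_null (H i)) -> cyc_null (fun x => \sum_(i <- r) H i x).
Proof.
move=> Hi; elim: r => [|i r IH].
  rewrite (_ : (fun _ => _) = fun=> 0); first exact: cyc_null0.
  by apply/funext => x; rewrite big_nil.
rewrite (_ : (fun _ => _) = fun x => H i x + \sum_(j <- r) H j x).
  exact: cyc_nullD.
by apply/funext => x; rewrite big_cons.
Qed.

(** Each summand is the coboundary of [z |-> w (z_0)] for the [i]-th power of the shift. *)
Lemma cyc_null_penalty n (w : T -> R) : continuous w ->
  cyc_null (fun x : {ptws 'I_n.+1 -> T} => \sum_i (w (x i) - w (x ord0))).
Proof.
move=> cw; apply: cyc_null_sum => i.
have := @cyc_null_shiftB n.+1 i (fun x => w (x ord0)).
rewrite (_ : (fun x => _ - _) = fun x => w (x i) - w (x ord0)).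
  apply => x.
  apply: (@continuous_comp _ _ _ (fun y : {ptws 'I_n.+1 -> T} => y ord0) w).
    exact: ptws_proj_continuous.
  exact: cw.
apply/funext => x; rewrite iter_cyc_shift; congr (w (x _) - _).
apply/val_inj; apply: etrans (val_iter_ordS i (@ord0 n)) _.
by rewrite add0n modn_small.
Qed.

End cyclic_null.

(* On a compact set away from p the function f stays below its maximum f p by a
   fixed gap, which r g cannot compensate for small r; elsewhere g is below
   B + e. *)
Lemma perturbed_max_le (R : realType) (Y : topologicalType) (f g : Y -> R) p C
    (b B e : R) :
  continuous f -> continuous g -> compact C ->
  (forall y, f y <= f p) -> (forall y, f y = f p -> y = p) ->
  (forall y, `|g y| <= b) -> g p <= B -> (forall y, ~ C y -> g y <= B) ->
  0 < e ->
  exists2 r0, 0 < r0 &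
    forall r, 0 < r -> r < r0 -> forall y, f y + r * g y <= f p + r * (B + e).
Proof.
move=> cf cg cC fp fp_uniq gb gp gC e0.
pose U := [set y | g y < B + e].
have oU : open U by exact: (open_comp (f := g) (D := [set z | z < B + e])).
have cCU : compact (C `&` ~` U).
  apply: compact_closedI => //; exact: open_closedC.
have Up : U p by rewrite /U/= (le_lt_trans gp)// ltrDl.
have out r y : 0 < r -> ~ (C `&` ~` U) y -> f y + r * g y <= f p + r * (B + e).
  move=> r0 nCU; apply: lerD => //; rewrite ler_pM2l//.
  have [Uy|nUy] := pselect (U y); first exact: ltW.
  have /gC gyB : ~ C y by move=> Cy; apply: nCU.
  by rewrite (le_trans gyB)// lerDl ltW.
have [CU0|/nonemptyPn CU0] := pselect (C `&` ~` U !=set0); last first.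
  by exists 1 => // r r0 _ y; apply: out => //; rewrite CU0.
have [a [Ca nUa] amax] := continuous_compact_max cCU CU0 cf.
have fa : f a < f p.
  rewrite lt_neqAle fp andbT; apply/eqP => /fp_uniq ap; apply: nUa.
  by rewrite ap.
have d0 : 0 < b + `|B| + 1 by rewrite ltr_wpDl// addr_ge0// (le_trans _ (gb p)).
(* Below this threshold [r * b + r * |B|] is less than the gap [f p - f a], which settles the points
   of [C] outside [U]; the added 1 keeps the denominator positive. *)
exists ((f p - f a) / (b + `|B| + 1)); first by rewrite divr_gt0// subr_gt0.
move=> r r0; rewrite ltr_pdivlMr// => rd y.
have [CUy|] := pselect ((C `&` ~` U) y); last exact: out.
have fya := amax _ CUy.
have gyb : r * g y <= r * b by rewrite ler_pM2l// (le_trans (ler_norm _))// gb.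
have rB : - (r * `|B|) <= r * B.
  by rewrite -mulrN ler_pM2l// lerNl -normrN ler_norm.
have re : 0 <= r * e by rewrite mulr_ge0// ltW.
have : r * (b + `|B| + 1) = r * b + r * `|B| + r by ring.
rewrite mulrDr; lra.
Qed.

(** * Measurable selection of the fibre maximisers *)

Section selection.
Context {R : realType} {T : ptopologicalType} (n : nat).
Variables (phi : {ptws 'I_n.+1 -> T} -> R) (D : set T).

Definition is_fiber_max (x : T) (y : {ptws 'I_n -> T}) :=
  forall z, phi (fcons x z) <= phi (fcons x y).

Hypothesis cphi : continuous phi.
Hypothesis mD : measurable (D : set (borel T)).
Hypothesis D_uniq : forall x, D x -> exists! y, is_fiber_max x y.

(* Off D the selection is constant, so that it is measurable everywhere. *)
Definition fiber_max (x : T) : {ptws 'I_n -> T} :=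
  xget ((fun=> x) : {ptws 'I_n -> T}) [set y | D x /\ is_fiber_max x y].

Definition fiber_max_graph (x : T) : {ptws 'I_n.+1 -> T} :=
  fcons x (fiber_max x).

Local Notation P := fiber_max_graph.

Lemma fiber_maxP x : D x -> is_fiber_max x (fiber_max x).
Proof.
move=> Dx; have [y [ymax _]] := D_uniq Dx.
rewrite /fiber_max; case: xgetP => [z _ []//|/(_ y)].
by move=> /(_ (conj Dx ymax)).
Qed.

Lemma fiber_max_uniq x y : D x -> phi (fcons x y) = phi (P x) ->
  y = fiber_max x.
Proof.
move=> Dx yP; have [z [_ zuniq]] := D_uniq Dx.
rewrite -(zuniq _ (fiber_maxP Dx)); apply/esym/zuniq => t.
by rewrite yP; exact: fiber_maxP.
Qed.

Lemma fiber_max_out x : ~ D x -> fiber_max x = fun=> x.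
Proof. by move=> nDx; rewrite /fiber_max xgetPN// => y []. Qed.

Lemma le_fiber_max_graph (z : {ptws 'I_n.+1 -> T}) : D (z ord0) ->
  phi z <= phi (P (z ord0)).
Proof. by move=> Dz; rewrite -{1}(fcons_eta z); exact: fiber_maxP. Qed.

Lemma ereal_sup_fiber x : D x ->
  ereal_sup [set (phi (fcons x y))%:E | y in setT] = (phi (P x))%:E.
Proof.
move=> Dx; apply/eqP; rewrite eq_le; apply/andP; split.
  by apply: ge_ereal_sup => _ [y _ <-]; rewrite lee_fin; exact: fiber_maxP.
by apply: ereal_sup_ubound; exists (fiber_max x).
Qed.

Variables (w : nat -> T -> R) (K : nat -> set T).
Hypothesis cK : forall k, compact (K k).
Hypothesis wK : forall k x, ~ K k x -> w k x = 1.
Hypothesis w_cvg0 : forall x, w ^~ x @ \oo --> (0 : R).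

(** The pair [w], [K] is an exhaustion in functional form. As [w k] tends to 0, the finitely many
    coordinates eventually all have weight below 1, which places them in [K k]. *)
Lemma exhaust_box m (y : {ptws 'I_m -> T}) : exists k, forall i, K k (y i).
Proof.
have : \forall k \near \oo, forall i : 'I_m, w k (y i) < 1.
  by apply: filter_forall => i; apply: (cvgr_lt 0) => //; exact: w_cvg0.
move=> [k _ wk]; exists k => i; apply: contrapT => /wK wk1.
by have := wk k (leqnn k) i; rewrite wk1 ltxx.
Qed.

(** On [D], coordinate [i] of the maximiser lies in the closed set [F] iff for some [k] the supremum
    over the compact set [Y k] equals the full one: it is then attained on [Y k], and uniqueness
    identifies the point. Both suprema are measurable in [x]. *)
Lemma measurable_fiber_max i :
  @measurable_fun _ _ (borel T) (borel T) setT (fun x => fiber_max x i).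
Proof.
apply: borel_measurable_closed => F cF.
pose Y k := [set y : {ptws 'I_n -> T} | forall j, K k (y j)] `&`
            (fun y : {ptws 'I_n -> T} => y i) @^-1` F.
have cY k : compact (Y k).
  apply: compact_closedI; first exact: (@tychonoff _ (fun=> T) (fun=> K k)).
  by apply: preimage_closed => // y _; exact: ptws_proj_continuous.
pose s k (x : borel T) := ereal_sup [set (phi (fcons x y))%:E | y in Y k].
pose l (x : borel T) := ereal_sup [set (phi (fcons x y))%:E | y in setT].
have ms k : measurable_fun setT (s k) by exact: measurable_sup_fcons.
have ml : measurable_fun setT l by exact: measurable_sup_fcons.
rewrite [X in measurable X](_ : _ = (D `&` \bigcup_k [set x | (l x <= s k x)%E])
    `|` (~` D `&` F)).
  apply: measurableU; apply: measurableI => //; last 2 first.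
  - exact: measurableC.
  - exact: closed_borel.
  apply: bigcupT_measurable => k.
  by rewrite -[X in measurable X]setTI; exact: measurable_lee.
apply/seteqP; split=> x /=.
  have [Dx|nDx] := pselect (D x); last by rewrite fiber_max_out//; right.
  move=> Fx; left; split => //; have [k Kk] := exhaust_box (fiber_max x).
  exists k => //=; rewrite /l ereal_sup_fiber//.
  by apply: ereal_sup_ubound; exists (fiber_max x).
move=> [[Dx [k _ /=]]|[nDx Fx]]; last by rewrite fiber_max_out.
rewrite /l ereal_sup_fiber// /s.
have [Y0|/nonemptyPn->] := pselect (Y k !=set0); last first.
  by rewrite image_set0 ereal_sup0 leeNy_eq.
have [q Yq qmax] : exists2 q, Y k q &
    forall y, Y k y -> phi (fcons x y) <= phi (fcons x q).
  apply: continuous_compact_max (cY k) Y0 _ => y.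
  by apply: continuous_comp; [exact: fcons_continuousr|exact: cphi].
move=> Pq; suff <- : q = fiber_max x by exact: Yq.2.
apply: fiber_max_uniq => //; apply/eqP; rewrite eq_le fiber_maxP//=.
rewrite -lee_fin (le_trans Pq)//; apply: ge_ereal_sup => _ [y Yy <-].
by rewrite lee_fin; exact: qmax.
Qed.

Lemma measurable_fiber_max_graph i :
  @measurable_fun _ _ (borel T) (borel T) setT (fun x => P x i).
Proof.
rewrite /P; case: (unliftP ord0 i) => [j ->|->].
  by under eq_fun do rewrite fcons_lift; exact: measurable_fiber_max.
by under eq_fun do rewrite fcons0; exact: measurable_id.
Qed.

End selection.

(** * First-order condition at the optimal potential *)

Section transport.
Context {R : realType} {T : ptopologicalType} (n : nat).
Variable mu : probability (borel T) R.
Variables (c H0 : {ptws 'I_n.+1 -> T} -> R) (D : set T).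
Local Notation phi := (fun z => c z - H0 z).
Hypothesis cc : continuous c.
Hypothesis H0_null : cyc_null H0.
Hypothesis mD : measurable (D : set (borel T)).
Hypothesis muD : {ae mu, forall x, D x}.
Hypothesis D_uniq : forall x, D x -> exists! y, is_fiber_max phi x y.
Hypothesis sT : @second_countable T.
Variables (w : nat -> T -> R) (K : nat -> set T).
Hypothesis cw : forall k, continuous (w k).
Hypothesis w01 : forall k x, 0 <= w k x <= 1.
Hypothesis cK : forall k, compact (K k).
Hypothesis wK : forall k x, ~ K k x -> w k x = 1.
Hypothesis w_cvg0 : forall x, w ^~ x @ \oo --> (0 : R).

Local Notation P := (fiber_max_graph phi D).
Local Notation L := (fun x => phi (P x)).

Lemma dual_integrand_continuous : continuous phi.
Proof. by move=> z; apply: cvgB; [exact: cc|exact: H0_null.1]. Qed.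
Local Notation cphi := dual_integrand_continuous.

Lemma measurable_graph i :
  @measurable_fun _ _ (borel T) (borel T) setT (fun x => P x i).
Proof. exact: (measurable_fiber_max_graph cphi mD D_uniq cK wK w_cvg0). Qed.

Lemma measurable_comp_graph (F : {ptws 'I_n.+1 -> T} -> R) : continuous F ->
  @measurable_fun _ _ (borel T) R setT (fun x => F (P x)).
Proof.
move=> cF.
exact: (continuous_comp_measurable (X := borel T)
  (g := fun i (x : borel T) => P x i) sT measurable_graph cF).
Qed.

Lemma fiber_max_graph0 x : P x ord0 = x.
Proof. exact: fcons0. Qed.

Section perturbation.
Hypothesis intL : mu.-integrable setT (EFin \o L).
Hypothesis H0_min : forall H, dual_admissible mu c H ->
  (\int[mu]_x ell c H0 x <= \int[mu]_x ell c H x)%E.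

Lemma integral_ell_H0 : (\int[mu]_x ell c H0 x = \int[mu]_x (L x)%:E)%E.
Proof.
apply: ae_eq_integral => //.
- by apply: measurable_ell => //; exact: H0_null.1.
- exact: measurable_int intL.
- by apply: (aeS muD) => x Dx _; exact: (ereal_sup_fiber D_uniq).
Qed.

Section direction.
Variables (Q : {ptws 'I_n.+1 -> T} -> R) (b : R).
Hypothesis Q_null : cyc_null Q.
Hypothesis Qb : forall z, `|Q z| <= b.

Let l r x := ell c (fun z => H0 z + r * Q z) x.

Lemma perturbed_null r : cyc_null (fun z => H0 z + r * Q z).
Proof. by apply: cyc_nullD => //; exact: cyc_nullM. Qed.

Lemma measurable_ell_perturbed r :
  @measurable_fun _ _ (borel T) (\bar R) setT (l r).
Proof. by apply: measurable_ell => //; exact: (perturbed_null r).1. Qed.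

Lemma le_ell_perturbed r x a :
  (forall y, phi (fcons x y) + r * - Q (fcons x y) <= a) ->
  (l r x <= a%:E)%E.
Proof.
move=> ya; apply: ge_ereal_sup => _ [y _ <-]; rewrite lee_fin.
by apply: le_trans (ya y); rewrite mulrN opprD addrA.
Qed.

Lemma ell_perturbed_near r x : 0 < r -> D x ->
  ((L x - r * b)%:E <= l r x)%E && (l r x <= (L x + r * b)%:E)%E.
Proof.
move=> r0 Dx; apply/andP; split.
  apply: (@le_trans _ _ (c (P x) - (H0 (P x) + r * Q (P x)))%:E); last first.
    by apply: ereal_sup_ubound; exists (fiber_max phi D x).
  rewrite lee_fin opprD addrA lerD// lerN2 ler_pM2l//.
  by rewrite (le_trans (ler_norm _)).
apply: le_ell_perturbed => y; apply: lerD.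
  exact: (fiber_maxP D_uniq Dx).
by rewrite ler_pM2l// (le_trans (ler_norm _))// normrN.
Qed.

Lemma ell_perturbed_fin r x : 0 < r -> D x -> (fine (l r x))%:E = l r x.
Proof.
move=> r0 Dx; rewrite fineK//; have /andP[l1 l2] := ell_perturbed_near r0 Dx.
by rewrite fin_numElt (lt_le_trans _ l1) ?ltNyr// (le_lt_trans l2) ?ltry.
Qed.

(** Adding [r * Q] moves the supremum by at most [r * b]. The bound is uniform in [r] and so serves
    for dominated convergence as [r] tends to 0. *)
Lemma difference_quotient_bound r x : 0 < r -> D x ->
  `|r^-1 * (fine (l r x) - L x)| <= b.
Proof.
move=> r0 Dx; have := ell_perturbed_near r0 Dx.
rewrite -(ell_perturbed_fin r0 Dx) !lee_fin => /andP[l1 l2].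
rewrite normrM gtr0_norm ?invr_gt0// mulrC ler_pdivrMr// ler_norml mulrC.
by apply/andP; split; lra.
Qed.

Lemma integrable_ell_perturbed r : 0 < r -> mu.-integrable setT (l r).
Proof.
move=> r0; apply: (@ae_le_integrable _ (borel T) R mu (l r)
  (EFin \o (fun x => `|L x| + r * b))).
- exact: measurable_ell_perturbed.
- rewrite (_ : _ \o _ = (abse \o (EFin \o L)) \+ (EFin \o cst (r * b)%R))%E//.
  apply: integrableD => //; first exact: integrable_abse.
  exact: finite_measure_integrable_cst.
- apply: (aeS muD) => x Dx; have := ell_perturbed_near r0 Dx.
  rewrite -(ell_perturbed_fin r0 Dx) !lee_fin => /andP[l1 l2].
  apply: (@le_trans _ _ (`|L x| + r * b)); last exact: ler_norm.
  have := ler_norm (L x); have := ler_norm (- L x).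
  rewrite normrN ler_norml => ? ?.
  by apply/andP; split; lra.
Qed.

Lemma perturbed_admissible r : 0 < r ->
  dual_admissible mu c (fun z => H0 z + r * Q z).
Proof.
move=> r0; split; first exact: perturbed_null.
left; apply: integrable_lty => //; apply: integrable_funepos => //.
exact: integrable_ell_perturbed.
Qed.

(** Minimality of [H0] against the admissible competitor [H0 + r Q]; both integrals are finite, so
    they may be subtracted. *)
Lemma integral_difference_quotient_ge0 r : 0 < r ->
  (0 <= \int[mu]_x (r^-1 * (fine (l r x) - L x))%:E)%E.
Proof.
move=> r0.
have mfl : @measurable_fun _ _ (borel T) R setT (fine \o l r).
  apply: measurableT_comp (measurable_ell_perturbed r).
  exact: fine_measurable.
have il : (\int[mu]_x ell c (fun z => (H0 z + r * Q z)%R) x =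
           \int[mu]_x (fine (l r x))%:E)%E.
  apply: ae_eq_integral => //.
  - exact: measurable_ell_perturbed.
  - exact/measurable_EFinP.
  - by apply: (aeS muD) => x Dx _; apply/esym/ell_perturbed_fin.
have intl : mu.-integrable setT (EFin \o (fine \o l r)).
  apply: (ae_le_integrable _ (integrable_ell_perturbed r0)).
    exact/measurable_EFinP.
  apply: (aeS muD) => x Dx.
  by rewrite -[X in (_ <= `|X|)%E](ell_perturbed_fin r0 Dx).
have := H0_min (perturbed_admissible r0).
rewrite integral_ell_H0 il => Ll.
under eq_integral do rewrite EFinM EFinB.
rewrite integralZl//; last exact: integrableB.
apply: mule_ge0; first by rewrite lee_fin invr_ge0 ltW.
by rewrite integralB// sube_ge0// integrable_fin_num ?orbT.
Qed.

(* B has to control -Q only where the maximisers of the perturbed fibre problem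
   may accumulate: at P x and, as the space is not compact, at infinity. *)
Lemma integral_directional_ge0 (B : T -> R) (C : set {ptws 'I_n -> T}) :
  @measurable_fun _ _ (borel T) R setT B -> (forall x, `|B x| <= b) ->
  compact C -> (forall x, - Q (P x) <= B x) ->
  (forall x y, ~ C y -> - Q (fcons x y) <= B x) ->
  (0 <= \int[mu]_x (B x)%:E)%E.
Proof.
move=> mB Bb cC BP BC.
pose r m : R := m.+1%:R^-1.
have r0 m : 0 < r m by rewrite invr_gt0.
pose G m x := (r m)^-1 * (fine (l (r m) x) - L x).
have mG m : @measurable_fun _ _ (borel T) R setT (G m).
  apply: measurable_funM => //; apply: measurable_funB.
    apply: measurableT_comp (measurable_ell_perturbed (r m)).
    exact: fine_measurable.
  exact: (measurable_comp_graph cphi).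
(* The quotients [G m x] need not converge; only their limsup is bounded, by [B x]. Taking the
   maximum with [B x] yields a genuine limit, to which dominated convergence applies. *)
have cvgGB : {ae mu, forall x, setT x ->
    (fun m => (Num.max (G m x) (B x))%:E) @ \oo --> (B x)%:E}.
  apply: (aeS muD) => x Dx _; apply: cvg_EFin; first exact: nearW.
  apply/cvgrPdist_le => e e0 /=.
  have cf : continuous (fun y => phi (fcons x y)).
    move=> y; apply: (@continuous_comp _ _ _ (fcons x) phi); last exact: cphi.
    exact: fcons_continuousr.
  have cg : continuous (fun y => - Q (fcons x y)).
    have cQ : continuous (fun y => Q (fcons x y)).
      move=> y; apply: continuous_comp; last exact: Q_null.1.
      exact: fcons_continuousr.
    by move=> y; apply: cvgN; exact: cQ.
  have gb y : `|- Q (fcons x y)| <= b by rewrite normrN.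
  have [r1 r10 r1P] := perturbed_max_le cf cg cC (fiber_maxP D_uniq Dx)
    (fun y => @fiber_max_uniq _ _ _ phi D D_uniq x y Dx) gb (BP x) (BC x) e0.
  have := near_infty_natSinv_lt (PosNum r10); apply: filterS => m /= rm.
  have : (l (r m) x <= (L x + r m * (B x + e))%:E)%E.
    by apply: le_ell_perturbed => y; exact: r1P.
  rewrite -ell_perturbed_fin// lee_fin => lB.
  have GB : G m x <= B x + e.
    by rewrite /G mulrC ler_pdivrMr// mulrC; lra.
  have Bmax : B x <= Num.max (G m x) (B x) by rewrite le_max lexx orbT.
  have maxB : Num.max (G m x) (B x) <= B x + e.
    by rewrite ge_max GB/= lerDl ltW.
  by rewrite ler_norml; apply/andP; split; lra.
have bGB : {ae mu, forall x, forall m, setT x ->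
    (`|(Num.max (G m x) (B x))%:E| <= (EFin \o cst b) x)%E}.
  apply: (aeS muD) => x Dx m _; rewrite lee_fin.
  have Gb := difference_quotient_bound (r0 m) Dx.
  by rewrite /Num.max; case: ifP.
have mGB m : @measurable_fun _ _ (borel T) (\bar R) setT
    (fun x => (Num.max (G m x) (B x))%:E).
  by apply/measurable_EFinP; apply: measurable_maxr => //; exact: mG.
have mEB : @measurable_fun _ _ (borel T) (\bar R) setT (EFin \o B).
  exact/measurable_EFinP.
have [_ _ cvg] := dominated_convergence measurableT mGB mEB cvgGB
  (finite_measure_integrable_cst mu b measurableT) bGB.
rewrite -[leRHS](cvg_lim _ cvg)//.
apply: lime_ge; first by apply/cvg_ex; eexists; exact: cvg.
apply: nearW => m; apply: le_trans (integral_difference_quotient_ge0 (r0 m)) _.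
apply: ae_le_integral => //.
- by apply/measurable_EFinP; exact: mG.
- by apply: aeW => x; rewrite lee_fin le_max lexx.
Qed.

End direction.

(* The penalty b * sum_i (w (z i) - w (z 0)), with b twice the bound of H, keeps
   the perturbed maximisers in the compact set where w < 1; its contribution to
   the integral is at most a multiple of the integral of w. *)
Lemma integral_null_le H b k : cyc_null H -> (forall z, `|H z| <= b) ->
  \int[mu]_x H (P x) <= 2 * b * n.+1%:R * \int[mu]_x w k x.
Proof.
move=> H_null Hb.
have b0 : 0 <= b by exact: le_trans (Hb point).
pose Q (z : {ptws 'I_n.+1 -> T}) :=
  H z + 2 * b * \sum_i (w k (z i) - w k (z ord0)).
have Q_null : cyc_null Q.
  by apply: cyc_nullD => //; apply: cyc_nullM; exact: cyc_null_penalty.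
have sumw (z : {ptws 'I_n.+1 -> T}) : \sum_i (w k (z i) - w k (z ord0)) =
    \sum_i w k (z i) - n.+1%:R * w k (z ord0).
  by rewrite big_split/= sumrN sumr_const card_ord mulr_natl.
have w0 x : 0 <= w k x by have /andP[] := w01 k x.
have w1 x : w k x <= 1 by have /andP[] := w01 k x.
have Qb z : `|Q z| <= b + 2 * b * n.+1%:R.
  rewrite (le_trans (ler_normD _ _))// lerD// normrM ger0_norm ?mulr_ge0//.
  rewrite ler_wpM2l ?mulr_ge0// (le_trans (ler_norm_sum _ _ _))//.
  apply: (@le_trans _ _ (\sum_(i < n.+1) 1)); last first.
    by rewrite sumr_const card_ord.
  apply: ler_sum => i _; rewrite ler_norml.
  have := w0 (z i); have := w1 (z i); have := w0 (z ord0); have := w1 (z ord0).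
  by move=> *; apply/andP; split; lra.
pose B x := 2 * b * n.+1%:R * w k x - H (P x).
have mHP : @measurable_fun _ _ (borel T) R setT (fun x => H (P x)).
  exact: (measurable_comp_graph H_null.1).
have mw : @measurable_fun _ _ (borel T) R setT (w k).
  exact: continuous_borel_measurable.
have bM : 0 <= 2 * b * n.+1%:R by rewrite !mulr_ge0.
have iHP : mu.-integrable setT (EFin \o (fun x => H (P x))).
  exact: (@bounded_integrable _ (borel T) R mu _ b).
have iw : mu.-integrable setT (EFin \o w k).
  apply: (@bounded_integrable _ (borel T) R mu _ 1) => // x.
  by rewrite ger0_norm.
have iaw : mu.-integrable setT (EFin \o (fun x => 2 * b * n.+1%:R * w k x)).
  rewrite (_ : _ \o _ = (fun x => (2 * b * n.+1%:R)%:E * (EFin \o w k) x)%E)//.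
  exact: integrableZl.
have : (0 <= \int[mu]_x (B x)%:E)%E.
  apply: (integral_directional_ge0 Q_null Qb
    (C := [set y : {ptws 'I_n -> T} | forall j, K k (y j)])).
  - by apply: measurable_funB => //; exact: measurable_funM.
  - move=> x; rewrite (le_trans (ler_normB _ _))// addrC lerD//.
    by rewrite normrM !ger0_norm// ler_piMr.
  - exact: (@tychonoff _ (fun=> T) (fun=> K k)).
  (* At [P x] the nonnegative weights [w k (P x i)] enter [- Q] with a minus sign and are
     dropped. *)
  - move=> x; rewrite /Q /B sumw fiber_max_graph0.
    have : 0 <= 2 * b * \sum_i w k (P x i).
      by rewrite !mulr_ge0// sumr_ge0.
    rewrite mulrBr !mulrA; lra.
  (* A coordinate outside [K k] has weight 1, so the weights contribute at least [2 * b], which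
     absorbs the difference between [H (P x)] and [H (fcons x y)]. *)
  - move=> x y /existsNP[j /wK wy]; rewrite /Q /B sumw fcons0.
    have : 2 * b <= 2 * b * \sum_i w k (fcons x y i).
      rewrite ler_peMr ?mulr_ge0// (bigD1 (lift ord0 j))//= fcons_lift wy.
      by rewrite lerDl sumr_ge0.
    have := ler_norm (H (P x)); have := ler_norm (- H (fcons x y)).
    rewrite normrN; have := Hb (P x); have := Hb (fcons x y).
    rewrite mulrBr !mulrA; lra.
move=> /fine_ge0; rewrite -[fine _]/(\int[mu]_x B x) /B RintegralB//.
by rewrite RintegralZl// subr_ge0.
Qed.

Lemma integral_w_cvg0 : (fun k => \int[mu]_x w k x) @ \oo --> (0 : R).
Proof.
have mw k : @measurable_fun _ _ (borel T) R setT (w k).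
  exact: continuous_borel_measurable.
have : (fun k => \int[mu]_x (w k x)%:E)%E @ \oo --> (\int[mu]_x (cst 0 x))%E.
  apply: (@dominated_cvg _ (borel T) R mu setT measurableT
    (fun k x => (w k x)%:E) (cst 0%E) (EFin \o cst 1)) => //.
  - by move=> k; apply/measurable_EFinP; exact: mw.
  - move=> x _; apply: cvg_EFin; first exact: nearW.
    exact: w_cvg0.
  - exact: finite_measure_integrable_cst.
  - move=> k x _ /=; rewrite lee_fin; have /andP[w0 w1] := w01 k x.
    by rewrite ger0_norm.
by rewrite integral0 => /fine_cvg.
Qed.

(** Letting [k] tend to infinity in [integral_null_le] gives one inequality; the other follows by
    applying it to the opposite of [H]. *)
Lemma integral_null_eq0 H b : cyc_null H -> (forall z, `|H z| <= b) ->
  \int[mu]_x H (P x) = 0.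
Proof.
have le0 F : cyc_null F -> (forall z, `|F z| <= b) -> \int[mu]_x F (P x) <= 0.
  move=> F_null Fb.
  have cvg0 : (fun k => 2 * b * n.+1%:R * \int[mu]_x w k x) @ \oo --> (0 : R).
    rewrite -(mulr0 (2 * b * n.+1%:R)).
    by apply: cvgM; [exact: cvg_cst|exact: integral_w_cvg0].
  rewrite -(cvg_lim _ cvg0)//.
  apply: limr_ge; first by apply/cvg_ex; eexists; exact: cvg0.
  by apply: nearW => k; exact: integral_null_le.
move=> H_null Hb; apply/eqP; rewrite eq_le le0//=.
have := @le0 (fun z => -1 * H z) (cyc_nullM _ H_null).
rewrite RintegralZl//; last first.
  apply: (@bounded_integrable _ (borel T) R mu _ b) => //.
  exact: (measurable_comp_graph H_null.1).
rewrite mulN1r oppr_le0; apply => z.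
by rewrite mulN1r normrN.
Qed.

End perturbation.
End transport.

(** * Cyclically invariant laws carried by a graph *)

(** The form in which the metric of the space is used: it turns identities between integrals of
    continuous functions into identities between measures of closed sets. *)
Definition closed_sets_approximable (R : realType) (T : topologicalType) :=
  forall F : set T, closed F ->
    exists f : nat -> T -> R, [/\ forall k, continuous (f k),
      forall k x, 0 <= f k x <= 1 & forall x, f ^~ x @ \oo --> (\1_F x : R)].

Section cyclic_graph.
Context {R : realType} {T : ptopologicalType} (n : nat).
Variable mu : probability (borel T) R.
Variable P : T -> {ptws 'I_n.+1 -> T}.
Hypothesis P0 : forall x, P x ord0 = x.
Hypothesis mP : forall i, @measurable_fun _ _ (borel T) (borel T) setT (P ^~ i).
Hypothesis P_null : forall (H : {ptws 'I_n.+1 -> T} -> R) b,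
  cyc_null H -> (forall z, `|H z| <= b) -> \int[mu]_x H (P x) = 0.
Hypothesis hT : hausdorff_space T.
Hypothesis sT : @second_countable T.
Hypothesis closed_approx : closed_sets_approximable R T.

Lemma integral_cvg_joint_law (f g : nat -> T -> R) (A B : set T) i j :
  closed A -> closed B ->
  (forall k, continuous (f k)) -> (forall k, continuous (g k)) ->
  (forall k x, 0 <= f k x <= 1) -> (forall k x, 0 <= g k x <= 1) ->
  (forall x, f ^~ x @ \oo --> (\1_A x : R)) ->
  (forall x, g ^~ x @ \oo --> (\1_B x : R)) ->
  (fun k => \int[mu]_x (f k (P x i) * g k (P x j))%:E)%E @ \oo -->
  mu ((P ^~ i) @^-1` A `&` (P ^~ j) @^-1` B).
Proof.
move=> cA cB cf cg f01 g01 fA gB.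
have mA : measurable ((P ^~ i : borel T -> borel T) @^-1` A).
  rewrite -[X in measurable X]setTI; apply: (mP i) => //.
  exact: closed_borel.
have mB : measurable ((P ^~ j : borel T -> borel T) @^-1` B).
  rewrite -[X in measurable X]setTI; apply: (mP j) => //.
  exact: closed_borel.
set AB := _ `&` _.
have mAB : measurable (AB : set (borel T)) by exact: measurableI.
rewrite -[AB]setIT -(integral_indic mu measurableT mAB).
apply: (@dominated_cvg _ (borel T) R mu setT measurableT _
    (fun x => (\1_AB x)%:E) (EFin \o cst 1)) => //.
- move=> k; apply/measurable_EFinP; apply: measurable_funM.
    apply: measurableT_comp (mP i).
    exact: continuous_borel_measurable.
  apply: measurableT_comp (mP j).
  exact: continuous_borel_measurable.
- move=> x _; apply: cvg_EFin; first exact: nearW.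
  rewrite indicI /=; apply: cvgM; first exact: fA.
  exact: gB.
- exact: finite_measure_integrable_cst.
- move=> k x _ /=; rewrite lee_fin.
  have /andP[f0 f1] := f01 k (P x i); have /andP[g0 g1] := g01 k (P x j).
  by rewrite ger0_norm ?mulr_ge0// mulr_ile1.
Qed.

Local Notation S := (fun x => P x (ordS ord0)).

Let mS : @measurable_fun _ _ (borel T) (borel T) setT S.
Proof. exact: mP. Qed.

(* Testing with the cyclic coboundary of (f o z_0) (g o z_i). *)
Lemma joint_law_closed i (A B : set T) : closed A -> closed B ->
  mu (A `&` (P ^~ i) @^-1` B) = mu (S @^-1` A `&` (P ^~ (ordS i)) @^-1` B).
Proof.
move=> cA cB; have [f [cf f01 fA]] := closed_approx cA.
have [g [cg g01 gB]] := closed_approx cB.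
have := integral_cvg_joint_law (i := ord0) (j := i) cA cB cf cg f01 g01 fA gB.
have -> : (P ^~ ord0) @^-1` A = A by apply/funext => x /=; rewrite P0.
move=> h1.
have h2 := integral_cvg_joint_law (i := ordS ord0) (j := ordS i)
  cA cB cf cg f01 g01 fA gB.
(* If the approximating integrals agree for every [k], so do their limits, which are the two
   measures to be compared. *)
suff E : (fun k => \int[mu]_x (f k (P x ord0) * g k (P x i))%:E)%E =
    (fun k => \int[mu]_x (f k (S x) * g k (P x (ordS i)))%:E)%E.
  rewrite E in h1; apply: cvg_unique h1 h2.
  exact: ereal_hausdorff.
apply/funext => k.
pose G (z : {ptws 'I_n.+1 -> T}) := f k (z ord0) * g k (z i).
have cG : continuous G.
  move=> z; apply: cvgM.
    apply: (@continuous_comp _ _ _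
      (fun y : {ptws 'I_n.+1 -> T} => y ord0) (f k)).
      exact: ptws_proj_continuous.
    exact: cf.
  apply: (@continuous_comp _ _ _ (fun y : {ptws 'I_n.+1 -> T} => y i) (g k)).
    exact: ptws_proj_continuous.
  exact: cg.
have G01 z : 0 <= G z <= 1.
  have /andP[f0 f1] := f01 k (z ord0); have /andP[g0 g1] := g01 k (z i).
  by rewrite mulr_ge0// mulr_ile1.
have iG j l : mu.-integrable setT
    (EFin \o (fun x : borel T => f k (P x j) * g k (P x l))).
  apply: (@bounded_integrable _ (borel T) R mu _ 1) => [|x].
    apply: measurable_funM.
      apply: measurableT_comp (mP j).
      exact: continuous_borel_measurable.
    apply: measurableT_comp (mP l).
    exact: continuous_borel_measurable.
  have /andP[f0 f1] := f01 k (P x j); have /andP[g0 g1] := g01 k (P x l).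
  by rewrite ger0_norm ?mulr_ge0// mulr_ile1.
have := P_null (b := 1) (cyc_null_shiftB 1 cG).
rewrite /G /= /cyc_shift RintegralB// => h.
rewrite -(fineK (integrable_fin_num measurableT (iG ord0 i))).
rewrite -(fineK (integrable_fin_num measurableT (iG (ordS ord0) (ordS i)))).
congr EFin; apply/esym/eqP; rewrite -subr_eq0; apply/eqP; apply: h => z.
have := G01 (@cyc_shift T n.+1 z); have := G01 z.
rewrite /G /cyc_shift /= => /andP[? ?] /andP[? ?].
by rewrite ler_norml; apply/andP; split; lra.
Qed.

(** For fixed [B] both sides are finite measures in [A] that agree on closed sets, a generating
    class stable under intersection. *)
Lemma joint_law i (A B : set T) : measurable (A : set (borel T)) -> closed B ->
  mu (A `&` (P ^~ i) @^-1` B) = mu (S @^-1` A `&` (P ^~ (ordS i)) @^-1` B).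
Proof.
move=> mA cB.
have mB j : measurable ((P ^~ j : borel T -> borel T) @^-1` B).
  rewrite -[X in measurable X]setTI; apply: (mP j) => //.
  exact: closed_borel.
pose m1 : {measure set (borel T) -> \bar R} := mrestr mu (mB i).
pose m2 : {measure set (borel T) -> \bar R} := mrestr mu (mB (ordS i)).
have [m3 m3E] : exists m3 : {measure set (borel T) -> \bar R},
    forall F, m3 F = m2 (S @^-1` F).
  unshelve eexists (pushforward m2 (S : borel T -> borel T)); first exact: mS.
  by [].
rewrite -[LHS]/(m1 A) -[RHS]/(m2 (S @^-1` A)) -m3E.
apply: (@measure_unique _ R (borel T) [set F : set T | closed F]
  (fun=> setT)) => //.
- apply/seteqP; split; apply: smallest_sub.
  + exact: smallest_sigma_algebra.
  + move=> U oU; rewrite -(setCK U).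
    apply: sigma_algebraC; apply: sub_sigma_algebra.
    exact: open_closedC.
  + exact: sigma_algebra_measurable.
  + by move=> F /= cF; exact: closed_borel.
- by move=> F G /= cF cG; exact: closedI.
- by rewrite bigcup_const.
- by move=> F cF; rewrite m3E; exact: joint_law_closed.
- by move=> k; rewrite /m1 /mrestr (le_lt_trans (probability_le1 mu _)) ?ltry//;
    apply: measurableI.
Qed.

(** Case of [joint_law] in which [B] is the whole space. *)
Lemma graph_map_preserving : @measure_preserving R T mu S.
Proof.
split; first exact: mS.
move=> A mA; have := joint_law ord0 mA closedT.
by rewrite !preimage_setT !setIT => ->.
Qed.

(* Closures of basic open sets are countably many closed sets separating the
   points, so a.e. equality can be checked on them. *)
Lemma graph_map_shift : {ae mu, forall x, forall i, P (S x) i = P x (ordS i)}.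
Proof.
have [E oE nE] := second_countable_enum sT.
pose bad i k := [set x : borel T | ~ closure (E k) (P (S x) i)] `&`
  [set x : borel T | closure (E k) (P x (ordS i))].
have bad0 i k : mu.-negligible (bad i k).
  have cE : closed (closure (E k)) by exact: closed_closure.
  have mA : measurable ((P ^~ i : borel T -> borel T) @^-1` (~` closure (E k))).
    rewrite -[X in measurable X]setTI; apply: (mP i) => //.
    by apply: measurableC; exact: closed_borel.
  have mB : measurable
      ((P ^~ (ordS i) : borel T -> borel T) @^-1` closure (E k)).
    rewrite -[X in measurable X]setTI; apply: (mP (ordS i)) => //.
    exact: closed_borel.
  exists (bad i k); split => //.
    apply: measurableI => //.
    rewrite -[X in measurable X]setTI; exact: (mS measurableT mA).
  (* With [A] the complement of the preimage of [B] under coordinate [i], the left-hand set is empty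
     and the right-hand one is [bad i k]. *)
  have := joint_law i mA cE.
  rewrite -preimage_setI setICl preimage_set0 measure0.
  by move=> <-.
apply: negligibleS (negligible_bigcup (fun k => negligible_bigcup (fun j =>
  bad0 (inord j) k))) => x /existsNP[i]; apply: contra_notP => nbad.
(* If the two points had disjoint neighbourhoods, a basic set inside [V] would miss [U], so its
   closure would contain [P x (ordS i)] but not [P (S x) i]. *)
apply/hT => U V nU nV; apply: contrapT => UV0.
have [k Ek EU] := nE _ _ nV.
apply: nbad; exists k => //; exists i => //; rewrite inord_val; split.
  move=> /(_ _ nU)[y [Ey Uy]]; apply: UV0; exists y; split => //.
  exact: EU.
by apply: subset_closure.
Qed.

(** The shift relation at all points of the orbit gives coordinate [k] of [P x] as the [k]-th
    iterate of [S]; at the last coordinate [ordS] wraps around to 0, which closes the orbit. *)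
Lemma graph_itinerary : {ae mu, forall x,
  P x = itinerary S x /\ iter n.+1 S x = x}.
Proof.
have [mS' muS] := graph_map_preserving.
have := ae_foralln (fun k => ae_iter mS' muS k graph_map_shift).
move/aeS; apply => x shift.
(* The relation is assumed along the whole orbit of [y], so that the induction can pass from [y] to
   [S y]. *)
have Piter k y : (forall j i, P (S (iter j S y)) i = P (iter j S y) (ordS i)) ->
    forall i : 'I_n.+1, i = k :> nat -> P y i = iter k S y.
  elim: k y => [|k IH] y yshift i ik.
    by rewrite (_ : i = ord0) ?P0//; exact: val_inj.
  have kn : (k < n.+1)%N by rewrite (leq_trans _ (ltn_ord i))// ik.
  have -> : i = ordS (Ordinal kn).
    by apply/val_inj => /=; rewrite -ik modn_small.
  have := yshift 0%N (Ordinal kn); rewrite /= => <-.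
  rewrite -[RHS]/(iter k.+1 S y) iterSr; apply: IH => // j l.
  by have := yshift j.+1 l; rewrite iterSr.
split; first by apply/funext => i; exact: Piter.
rewrite iterSr -(Piter n (S x) _ ord_max)//; last first.
  by move=> j l; have := shift j.+1 l; rewrite iterSr.
rewrite (shift 0%N) /= -[RHS]P0; congr (P x _).
by apply/val_inj => /=; rewrite modnn.
Qed.

End cyclic_graph.

(** * Attainment *)

(** Periodicity allows exponents to be reduced modulo N, so moving the starting point along the
    orbit rotates the itinerary. *)
Lemma iter_itinerary (T : ptopologicalType) n (S : T -> T) x i :
  iter n.+1 S x = x ->
  itinerary S (iter i S x) = iter i (@cyc_shift T n.+1) (itinerary S x).
Proof.
move=> Sx; have Smod m : iter m S x = iter (m %% n.+1) S x.
  rewrite {1}(divn_eq m n.+1) addnC iterD; congr (iter _ S _).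
  by elim: (m %/ n.+1)%N => [//|q IH]; rewrite mulSn iterD IH.
apply/funext => j; rewrite iter_cyc_shift /itinerary -iterD Smod.
by congr (iter _ S x); apply/esym/val_iter_ordS.
Qed.

Section attainment.
Context {R : realType} {T : ptopologicalType} (n : nat).
Variable mu : probability (borel T) R.
Variables (c H0 : {ptws 'I_n.+1 -> T} -> R).
Local Notation phi := (fun z => c z - H0 z).
Hypothesis cc : continuous c.
Hypothesis cub : has_ubound (range c).
Hypothesis H0_adm : dual_admissible mu c H0.
Hypothesis H0_min : dual_cost mu c H0 = dual_value mu c.
Hypothesis hT : hausdorff_space T.
Hypothesis sT : @second_countable T.
Hypothesis closed_approx : closed_sets_approximable R T.
Variables (w : nat -> T -> R) (K : nat -> set T).
Hypothesis cw : forall k, continuous (w k).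
Hypothesis w01 : forall k x, 0 <= w k x <= 1.
Hypothesis cK : forall k, compact (K k).
Hypothesis wK : forall k x, ~ K k x -> w k x = 1.
Hypothesis w_cvg0 : forall x, w ^~ x @ \oo --> (0 : R).
Variable D : set T.
Hypothesis mD : measurable (D : set (borel T)).
Hypothesis muD : {ae mu, forall x, D x}.
Hypothesis D_uniq : forall x, D x -> exists! y, is_fiber_max phi x y.

Local Notation P := (fiber_max_graph phi D).
Local Notation L := (fun x => phi (P x)).

Let H0_null : cyc_null H0. Proof. exact: H0_adm.1. Qed.
Let cphi : continuous phi. Proof. exact: dual_integrand_continuous. Qed.

Let mP i : @measurable_fun _ _ (borel T) (borel T) setT (fun x => P x i).
Proof. exact: (measurable_graph cc H0_null mD D_uniq cK wK w_cvg0). Qed.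

Let mL : @measurable_fun _ _ (borel T) R setT L.
Proof.
exact: (measurable_comp_graph cc H0_null mD D_uniq sT cK wK w_cvg0 cphi).
Qed.

(** Comparison with the zero potential, whose [ell] is bounded above by an upper bound of [c]. *)
Lemma dual_cost_lt_pinfty : (dual_cost mu c H0 < +oo)%E.
Proof.
have [M Mc] := cub.
have le0 x : (ell c (fun=> 0%R) x <= M%:E)%E.
  apply: ge_ereal_sup => _ [y _ <-]; rewrite subr0 lee_fin.
  by apply: Mc; exists (fcons x y).
have mell : @measurable_fun _ _ (borel T) (\bar R) setT (ell c (fun=> 0%R)).
  by apply: measurable_ell => // x; exact: cvg_cst.
have intM b : (\int[mu]_x (cst b%:E x) < +oo)%E.
  exact: integrable_lty (finite_measure_integrable_cst mu b measurableT).
have adm0 : dual_admissible mu c (fun=> 0%R).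
  split; first exact: cyc_null0.
  left; apply: le_lt_trans (intM `|M|); apply: ae_le_integral => //.
    exact: measurable_funepos.
  apply: aeW => x; rewrite funeposE ge_max lee_fin normr_ge0 andbT.
  by rewrite (le_trans (le0 x))// lee_fin ler_norm.
rewrite H0_min; apply: (@le_lt_trans _ _ (dual_cost mu c (fun=> 0%R))).
  by apply: ereal_inf_lbound; exists (fun=> 0%R).
apply: le_lt_trans (intM M); apply: ae_le_integral => //.
by apply: aeW => x; exact: le0.
Qed.

Lemma integrable_potential_pos :
  mu.-integrable setT (fun x => (Num.max (L x) 0)%:E).
Proof.
have mell : @measurable_fun _ _ (borel T) (\bar R) setT (ell c H0).
  by apply: measurable_ell => //; exact: H0_null.1.
have mmax : @measurable_fun _ _ (borel T) (\bar R) setT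
    (fun x => (Num.max (L x) 0)%:E).
  by apply/measurable_EFinP; exact: measurable_maxr.
have fin : (\int[mu]_x (ell c H0)^\+%E x < +oo)%E.
  (* If instead the negative part has finite integral, a dual cost below +oo forces the positive
     part to have one as well. *)
  have [//|fn] := H0_adm.2; have := dual_cost_lt_pinfty.
  rewrite /dual_cost integralE.
  have : (0 <= \int[mu]_x (ell c H0)^\-%E x)%E by exact: integral_ge0.
  move: fn; move: (\int[mu]_x (ell c H0)^\- x)%E (\int[mu]_x (ell c H0)^\+ x)%E.
  by move=> [r| |] [s| |] //= _ _ _; exact: ltry.
apply/integrableP; split => //; apply: le_lt_trans fin.
apply: ae_le_integral.
- exact: measurableT_comp.
- exact: measurable_funepos.
- apply: (aeS muD) => x Dx; rewrite funeposE.
  rewrite [ell _ _ _](ereal_sup_fiber D_uniq Dx) -EFin_max.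
  by rewrite gee0_abs// lee_fin le_max lexx orbT.
Qed.

Section cyclic_map.
Variable S : T -> T.
Hypothesis cS : cyc_map mu n.+1 S.
Local Notation f := (fun x => c (@itinerary T n.+1 S x)).

Lemma measurable_itinerary_cost : @measurable_fun _ _ (borel T) R setT f.
Proof.
apply: (continuous_comp_measurable (X := borel T)
  (g := fun i (x : borel T) => iter i S x) sT _ cc) => i.
exact: iter_measurable cS.1.1 i.
Qed.

Lemma integrable_itinerary_cost_pos :
  mu.-integrable setT (fun x => (Num.max (f x) 0)%:E).
Proof.
have [M Mc] := cub.
apply: (@bounded_integrable _ (borel T) R mu _ `|M|) => [|x].
  by apply: measurable_maxr => //; exact: measurable_itinerary_cost.
rewrite ger0_norm ?le_max ?lexx ?orbT// ge_max normr_ge0 andbT.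
by apply: le_trans (ler_norm M); apply: Mc; exists (itinerary S x).
Qed.

(* H0 cancels along the orbits of S. *)
Lemma orbit_sum_phi x : iter n.+1 S x = x ->
  \sum_(i < n.+1) f (iter i S x) =
  \sum_(i < n.+1) phi (@itinerary T n.+1 S (iter i S x)).
Proof.
move=> Sx; rewrite [RHS]big_split/= sumrN.
under [X in _ = _ - X]eq_bigr do rewrite iter_itinerary//.
by rewrite H0_null.2 subr0.
Qed.

(** Weak duality: on an orbit [c] and [phi] have the same sum, and each [phi] term is at most the
    fibre maximum over its first coordinate. *)
Lemma cyc_cost_le : (cyc_cost mu c S <= \int[mu]_x (L x)%:E)%E.
Proof.
have [[mS muS] Sx] := cS.
apply: (orbit_le_integral (N := n.+1) mS muS) => //.
- exact: measurable_itinerary_cost.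
- exact: integrable_itinerary_cost_pos.
- exact: integrable_potential_pos.
have DS := ae_foralln (fun k => ae_iter mS muS k muD).
apply: (aeS (aeI DS Sx)) => x [Dx {}Sx]; rewrite orbit_sum_phi//.
by apply: ler_sum => i _; exact: (le_fiber_max_graph D_uniq (Dx i)).
Qed.

(** Equality case of weak duality: every itinerary along almost every orbit is a fibre maximiser. *)
Lemma cyc_cost_ge : {ae mu, forall x, P x = itinerary S x} ->
  (\int[mu]_x (L x)%:E <= cyc_cost mu c S)%E.
Proof.
move=> PS; have [[mS muS] Sx] := cS.
apply: (orbit_le_integral (N := n.+1) mS muS) => //.
- exact: measurable_itinerary_cost.
- exact: integrable_potential_pos.
- exact: integrable_itinerary_cost_pos.
have PS' := ae_foralln (fun k => ae_iter mS muS k PS).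
apply: (aeS (aeI PS' Sx)) => x [Px {}Sx]; rewrite orbit_sum_phi//.
by apply: ler_sum => i _; rewrite Px.
Qed.

End cyclic_map.

Theorem MK_cyc_attained : exists2 S : T -> T,
  cyc_map mu n.+1 S & cyc_cost mu c S = MK_cyc mu c.
Proof.
have MK_le : (MK_cyc mu c <= \int[mu]_x (L x)%:E)%E.
  by apply: ge_ereal_sup => _ [S cS <-]; exact: cyc_cost_le.
have MK_ge S : cyc_map mu n.+1 S -> (cyc_cost mu c S <= MK_cyc mu c)%E.
  by move=> cS; apply: ereal_sup_ubound; exists S.
(* When [L] is not integrable the weak duality bound is -oo, and the identity, itself a cyclic map,
   attains it. *)
have [intL|nintL] := pselect (mu.-integrable setT (EFin \o L)); last first.
  have LNy := integral_Ny mL integrable_potential_pos nintL.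
  have cid : cyc_map mu n.+1 (@id T).
    split; first by split; [exact: measurable_id|].
    by apply: aeW => x; elim: n.+1.
  exists id => //; move: MK_le (MK_ge _ cid).
  by rewrite LNy leeNy_eq => /eqP ->; rewrite leeNy_eq => /eqP.
have opt H : dual_admissible mu c H ->
    (\int[mu]_x ell c H0 x <= \int[mu]_x ell c H x)%E.
  move=> Hadm; rewrite -[leLHS]/(dual_cost mu c H0) H0_min.
  by apply: ereal_inf_lbound; exists H.
have P_null := integral_null_eq0 cc H0_null mD muD D_uniq sT cw w01 cK wK w_cvg0
  intL opt.
have P0 x : P x ord0 = x by exact: fcons0.
have pres := graph_map_preserving P0 mP P_null closed_approx.
have itin := graph_itinerary P0 mP P_null hT sT closed_approx.
set S := fun x => P x (ordS ord0) in pres itin.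
have cS : cyc_map mu n.+1 S by split=> //; apply: (aeS itin) => x [].
exists S => //; apply/eqP; rewrite eq_le MK_ge//=.
by apply: le_trans MK_le _; apply: cyc_cost_ge => //; apply: (aeS itin) => x [].
Qed.

End attainment.

(** * Open subsets of a Euclidean space *)

Section distance.
Context {R : realType} (V : normedModType R).
Implicit Types (F : set V) (x y : V).

(* Adding 1 to the set of distances makes the empty F harmless. *)
Definition truncated_dist F x : R := inf (1 |` [set `|x - y| | y in F]).

Lemma truncated_dist_has_inf F x : has_inf (1 |` [set `|x - y| | y in F]).
Proof.
split; first by exists 1; left.
by exists 0 => _ [->//|[y _ <-]].
Qed.

Lemma truncated_dist_ge0 F x : 0 <= truncated_dist F x.
Proof.
apply: lb_le_inf; first exact: (truncated_dist_has_inf F x).1.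
by move=> _ [->//|[y _ <-]].
Qed.

Lemma truncated_dist_le F x y : F y -> truncated_dist F x <= `|x - y|.
Proof.
move=> Fy; apply: ge_inf; first exact: (truncated_dist_has_inf F x).2.
by right; exists y.
Qed.

Lemma truncated_dist_lipschitz F x y :
  truncated_dist F x <= truncated_dist F y + `|x - y|.
Proof.
rewrite -lerBlDr; apply: lb_le_inf; first exact: (truncated_dist_has_inf F y).1.
move=> _ [->|[z Fz <-]]; rewrite lerBlDr.
  apply: (@le_trans _ _ 1); last by rewrite lerDl.
  apply: ge_inf; first exact: (truncated_dist_has_inf F x).2.
  by left.
apply: le_trans (truncated_dist_le x Fz) _.
have -> : x - z = (y - z) + (x - y) by rewrite [RHS]addrC addrA subrK.
exact: ler_normD.
Qed.

Lemma truncated_dist_continuous F : continuous (truncated_dist F).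
Proof.
move=> x; apply/cvgrPdist_lt => e e0; near=> y.
have xy : `|x - y| < e by near: y; exact: cvgr_dist_lt.
apply: le_lt_trans xy; rewrite ler_norml.
have := truncated_dist_lipschitz F x y; have := truncated_dist_lipschitz F y x.
by rewrite (distrC y); move=> *; apply/andP; split; lra.
Unshelve. all: by end_near. Qed.

Lemma truncated_dist_gt0 F x : closed F -> ~ F x -> 0 < truncated_dist F x.
Proof.
move=> cF nFx; have : nbhs x (~` F).
  by apply: open_nbhs_nbhs; split => //; exact: closed_openC.
move=> /nbhs_ballP[e /= e0 eF].
apply: (@lt_le_trans _ _ (Num.min 1 e)); first by rewrite lt_min ltr01.
apply: lb_le_inf; first exact: (truncated_dist_has_inf F x).1.
move=> _ [->|[y Fy <-]]; first by rewrite ge_min lexx.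
rewrite ge_min; apply/orP; right; rewrite leNgt; apply/negP => xye.
by apply: (eF y) => //; rewrite -ball_normE.
Qed.

Lemma truncated_dist_eq0 F x : F x -> truncated_dist F x = 0.
Proof.
move=> Fx; apply/eqP; rewrite eq_le truncated_dist_ge0 andbT.
by have := truncated_dist_le x Fx; rewrite subrr normr0.
Qed.

Lemma ramp_down_continuous (Y : topologicalType) (t : Y -> R) a :
  continuous t -> continuous (fun z => Num.max 0 (1 - a * t z)).
Proof.
move=> ct z; have c0 : {for z, continuous (cst 0 : Y -> R)} by exact: cvg_cst.
have cu : {for z, continuous (fun z : Y => 1 - a * t z)}.
  by apply: cvgB; [exact: cvg_cst|apply: cvgM; [exact: cvg_cst|exact: ct]].
exact: (continuous_max c0 cu).
Qed.

Lemma ramp_up_continuous (Y : topologicalType) (t : Y -> R) a :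
  continuous t -> continuous (fun z => Num.min 1 (a * t z)).
Proof.
move=> ct z; have c1 : {for z, continuous (cst 1 : Y -> R)} by exact: cvg_cst.
have cu : {for z, continuous (fun z : Y => a * t z)}.
  by apply: cvgM; [exact: cvg_cst|exact: ct].
exact: (continuous_min c1 cu).
Qed.

Lemma norm_addV_continuous (Y : topologicalType) (u : Y -> V) (t : Y -> R) :
  continuous u -> continuous t -> (forall z, 0 < t z) ->
  continuous (fun z => `|u z| + (t z)^-1).
Proof.
move=> cu ct t0 z; apply: cvgD; first by apply: cvg_norm; exact: cu.
by apply: cvgV; [rewrite gt_eqF|exact: ct].
Qed.

End distance.

Section open_domain.
Context {R : realType} (d : nat) (Om : set 'rV[R]_d) (Om0 : Om !=set0).
Local Notation X := (points Om0).
Local Notation sv := (set_val : X -> 'rV[R]_d).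

Lemma set_val_continuous : continuous sv.
Proof. exact: (@initial_continuous _ _ set_val). Qed.

Lemma points_nbhs (x : X) (U : set X) : nbhs x U ->
  exists2 W : set 'rV[R]_d, nbhs (sv x) W & sv @^-1` W `<=` U.
Proof.
move=> [_ [[W oW <-] Wx] WU]; exists W => //.
exact: open_nbhs_nbhs.
Qed.

Lemma points_hausdorff : hausdorff_space X.
Proof.
move=> x y xy; apply/val_inj; apply: (@norm_hausdorff R 'rV[R]_d) => U V nU nV.
have [z [Uz Vz]] := xy _ _ (set_val_continuous nU) (set_val_continuous nV).
by exists (sv z).
Qed.

(** The base consists of the traces of boxes with rational endpoints; balls of the row space are
    defined entrywise, so a small enough box fits in any ball. *)
Lemma points_second_countable : @second_countable X.
Proof.
pose box (q : 'rV[rat * rat]_d) : set X :=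
  [set x | forall j, ratr (q ord0 j).1 < sv x ord0 j < ratr (q ord0 j).2].
have box_open q : open (box q).
  exists [set v : 'rV[R]_d |
    forall j, ratr (q ord0 j).1 < v ord0 j < ratr (q ord0 j).2] => //.
  move=> v /= vq.
  exists (fun _ j => [set t : R | ratr (q ord0 j).1 < t < ratr (q ord0 j).2]).
    move=> i j; rewrite (ord1 i); have := vq j.
    set a := ratr _; set b := ratr _.
    by move=> vab; apply: near_in_itvoo; rewrite in_itv.
  by move=> u uq j; exact: uq.
exists (range box).
  by apply: sub_countable (card_image_le _ _) _; exact: countableP.
split=> [_ [q _ <-]//|x U /points_nbhs[W]].
move=> /nbhs_ballP[e /= e0 eW] WU.
have /choice[q qP] (j : 'I_d) : exists ab : rat * rat,
    sv x ord0 j - e < ratr ab.1 < sv x ord0 j /\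
    sv x ord0 j < ratr ab.2 < sv x ord0 j + e.
  have [a] : exists q : rat, ratr q \in `]sv x ord0 j - e, sv x ord0 j[.
    by apply: rat_in_itvoo; rewrite ltrBlDr ltrDl.
  have [b] : exists q : rat, ratr q \in `]sv x ord0 j, sv x ord0 j + e[.
    by apply: rat_in_itvoo; rewrite ltrDl.
  by rewrite !in_itv/=; exists (a, b).
exists (box (\row_j q j)); last first.
  move=> y xy; apply: WU; apply: eW; split => // i j; rewrite (ord1 i).
  have := xy j; rewrite !mxE => /andP[y1 y2].
  have [/andP[q1 q2] /andP[q3 q4]] := qP j.
  by rewrite -ball_normE /= ltr_norml; apply/andP; split; lra.
split; first by exists (\row_j q j).
move=> j; rewrite !mxE.
by have [/andP[q1 q2] /andP[q3 q4]] := qP j; apply/andP.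
Qed.

(** [F] is the trace of a closed set [C] of the ambient space, and the ramps [max (0, 1 - k t)],
    with [t] the truncated distance to [C], decrease to its indicator. *)
Lemma points_closed_sets_approximable : closed_sets_approximable R X.
Proof.
move=> F /closed_openC[U oU UF]; pose C := ~` U.
have cC : closed C by exact: open_closedC.
have FC x : F x <-> C (sv x).
  rewrite -[F]setCK -UF; split => //.
pose t x := truncated_dist C (sv x).
have ct : continuous t.
  move=> x; apply: (@continuous_comp _ _ _ sv); first exact: set_val_continuous.
  exact: truncated_dist_continuous.
have t0 x : 0 <= t x by exact: truncated_dist_ge0.
exists (fun k x => Num.max 0 (1 - k%:R * t x)); split.
- by move=> k; exact: ramp_down_continuous.
- move=> k x; rewrite le_max lexx/= ge_max ler01/= lerBlDr lerDl.
  by rewrite mulr_ge0.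
- move=> x; rewrite indicE.
  have [Fx|nFx] := pselect (F x).
    rewrite mem_set//= /t truncated_dist_eq0; last exact/FC.
    under eq_fun do rewrite mulr0 subr0 (max_r ler01).
    exact: cvg_cst.
  have tx : 0 < t x.
    by apply: truncated_dist_gt0 => // /FC.
  rewrite memNset//=; apply: cvg_near_cst.
  near=> k; apply/eqP; rewrite eq_le le_max lexx/= andbT ge_max lexx/= subr_le0.
  rewrite -ler_pdivrMr// ltW//.
  by near: k; exact: nbhs_infty_gtr.
Unshelve. all: by end_near. Qed.

(* h = |x| + 1 / d(x, complement of Om) has compact sublevel sets in Om, and
   w_k = min (1, h / (k + 1)). *)
Lemma points_exhaustion : open Om ->
  exists (w : nat -> X -> R) (K : nat -> set X),
  [/\ forall k, continuous (w k), forall k x, 0 <= w k x <= 1,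
      forall k, compact (K k), forall k x, ~ K k x -> w k x = 1 &
      forall x, w ^~ x @ \oo --> (0 : R)].
Proof.
move=> oOm; pose t x := truncated_dist (~` Om) (sv x).
have ct : continuous t.
  move=> x; apply: (@continuous_comp _ _ _ sv); first exact: set_val_continuous.
  exact: truncated_dist_continuous.
have t0 x : 0 < t x.
  apply: truncated_dist_gt0; first exact: open_closedC.
  by move=> /(_ (set_valP x)).
pose h x := `|sv x| + (t x)^-1.
have h0 x : 0 <= h x by rewrite addr_ge0// invr_ge0 ltW.
have ch : continuous h.
  apply: norm_addV_continuous => //; exact: set_val_continuous.
exists (fun k x => Num.min 1 (k.+1%:R^-1 * h x)).
exists (fun k => [set x | h x <= k.+1%:R]); split.
- by move=> k; exact: ramp_up_continuous.
- by move=> k x; rewrite ge_min lexx/= le_min ler01/= mulr_ge0.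
- move=> k.
  (* On the sublevel set both the norm and the inverse distance are at most [k + 1], so its image
     lies in this closed bounded set. *)
  pose A := [set v : 'rV[R]_d | `|v| <= k.+1%:R] `&`
            [set v | k.+1%:R^-1 <= truncated_dist (~` Om) v].
  have cA : compact A.
    apply: bounded_closed_compact.
      exists k.+1%:R; split; first exact: num_real.
      by move=> M kM v [vk _]; rewrite /= (le_trans vk)// ltW.
    apply: closedI.
      apply: (@preimage_closed _ _ (fun v : 'rV[R]_d => `|v|)
        [set r | r <= k.+1%:R]).
        by move=> v _; exact: norm_continuous.
      exact: closed_le.
    apply: (@preimage_closed _ _ (truncated_dist (~` Om))
      [set r | k.+1%:R^-1 <= r]).
      by move=> v _; exact: truncated_dist_continuous.
    exact: closed_ge.
  have hA x : h x <= k.+1%:R -> A (sv x).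
    move=> hx; split => /=.
      by rewrite (le_trans _ hx)// lerDl invr_ge0 ltW.
    rewrite -[leRHS]invrK lef_pV2 ?posrE ?invr_gt0//; last exact: t0.
    by rewrite (le_trans _ hx)// lerDr.
  (* Compactness is pulled back from [A]: the image of [F] clusters at some [v] in [A], which lies
     in [Om] since its distance to the complement is positive; its lift is a cluster point of [F],
     and the sublevel set is closed. *)
  move=> F FF Fh.
  have [v [Av Fv]] := cA (sv @ F) _ (filterS hA Fh).
  have Omv : v \in Om.
    apply/mem_set; apply: contrapT => nOmv; have [_ /=] := Av.
    by rewrite truncated_dist_eq0// leNgt invr_gt0 ltr0n.
  pose x : X := exist _ v Omv.
  have Fx : cluster F x.
    move=> G U FG /points_nbhs[W nW WU].
    have [_ [[y Gy <-] Wy]] := Fv (sv @` G) W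
      (filterS (@preimage_image _ _ sv G) FG) nW.
    by exists y; split => //; exact: WU.
  exists x; split => //=.
  have : closed [set x | h x <= k.+1%:R].
    apply: (@preimage_closed _ _ h [set r | r <= k.+1%:R]).
      by move=> y _; exact: ch.
    exact: closed_le.
  apply => U nU.
  by have [y [? ?]] := Fx _ _ Fh nU; exists y.
- move=> k x /negP; rewrite -ltNge => kh; apply/min_idPl.
  by rewrite mulrC ler_pdivlMr// mul1r ltW.
- move=> x; apply: (@squeeze_cvgr _ _ _ _ (cst 0) (fun k => k.+1%:R^-1 * h x)).
  + apply: nearW => k; rewrite ge_min lexx orbT andbT le_min ler01/=.
    by rewrite mulr_ge0.
  + exact: cvg_cst.
  + rewrite -[X in _ --> X](mul0r (h x)); apply: cvgM; last exact: cvg_cst.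
    exact: cvg_harmonic.
Qed.

End open_domain.

Theorem theorem1p3 (R : realType) (d n : nat) (hN : (2 <= n.+1)%N)
  (Om : set 'rV[R]_d) (Om0 : Om !=set0) (Om_open : open Om)
  (Om_connected : connected Om)
  (mu : probability (borel (points Om0)) R)
  (c : {ptws 'I_n.+1 -> points Om0} -> R)
  (c_cont : continuous c) (c_ub : has_ubound (range c))
  (Hoo : {ptws 'I_n.+1 -> points Om0} -> R)
  (Hoo_adm : dual_admissible mu c Hoo)
  (Hoo_min : dual_cost mu c Hoo = dual_value mu c)
  (Hoo_uniq : {ae mu, forall x : points Om0,
     exists! y : {ptws 'I_n -> points Om0},
       forall z : {ptws 'I_n -> points Om0},
         c (fcons x z) - Hoo (fcons x z) <= c (fcons x y) - Hoo (fcons x y)}) :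
  exists2 S : points Om0 -> points Om0,
    cyc_map mu n.+1 S & cyc_cost mu c S = MK_cyc mu c.
Proof.
(* The exceptional set need not be measurable; [D] is taken as the complement of a measurable null
   set [N] containing it. *)
have [N [mN N0 subN]] := Hoo_uniq.
have [w [K [cw w01 cK wK w_cvg0]]] := points_exhaustion Om0 Om_open.
have muN : {ae mu, forall x, (~` N) x}.
  by exists N; split => // x; apply: contra_notP.
apply: (MK_cyc_attained c_cont c_ub Hoo_adm Hoo_min
  (@points_hausdorff _ _ _ Om0) (@points_second_countable _ _ _ Om0)
  (@points_closed_sets_approximable _ _ _ Om0)
  cw w01 cK wK w_cvg0 (measurableC mN) muN) => x.
by apply: contra_notP => nuniq; exact: subN.
Qed.
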